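(* Let $\{x^{s,k}\}$ be generated by Algorithm SNSPP with $S=\infty$, constant batch sizes $b_k^s=b$, and Option I. Assume (A1), (A2), (A4), (Ã3), (Ã5), and that $$\sum_{s=0}^\infty\sum_{k=0}^{m-1}\alpha_k^s=\infty,\qquad\sum_{s=0}^\infty\sum_{k=0}^{m-1}\alpha_k^s(\epsilon_k^s)^2<\infty,\qquad\alpha_k^s\le\min\{1,\hat\alpha\}\ \ \forall s,k,$$ where $\hat\alpha:=\bar\eta\,\max\{2L+\bar M,\ [1+m/\sqrt{2b}]\bar L+\max\{L,\bar M\}\}^{-1}$ for some $\bar\eta\in(0,1)$. Then for every $0\le k<m$, $\mathbb{E}\|F_{\mathrm{nat}}(x^{s,k})\|\to0$ and $F_{\mathrm{nat}}(x^{s,k})\to0$ almost surely as $s\to\infty$.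
   Context: Problem: $\min_x\psi(x)=f(x)+\phi(x)$, $f(x)=\frac1N\sum_{i=1}^N f_i(A_ix)$, $A_i\in\mathbb{R}^{m_i\times n}$, $f_i:\mathbb{R}^{m_i}\to\mathbb{R}$ continuously differentiable, $\phi:\mathbb{R}^n\to(-\infty,\infty]$ proper closed convex. $\hat f_i(z)=f_i(z)+\frac{\gamma_i}{2}\|z\|^2$, $\hat f_i^\ast$ its conjugate, $\mathcal D_i=\operatorname{int}\operatorname{dom}\hat f_i^\ast$. Assumptions: (A1) each $f_i$ is $L_i$-smooth and $\gamma_i$-weakly convex; (A2) $\psi^\star:=\inf\psi>-\infty$; (A4) each $\hat f_i^\ast$ is essentially differentiable with locally Lipschitz gradient on $\mathcal D_i\ne\emptyset$; (Ã3) $\operatorname{prox}_{\alpha\phi}$ is $\nu$-order semismooth for all $\alpha>0$ ($0<\nu\le1$); (Ã5) each $\nabla\hat f_i^\ast$ is $\nu$-order semismooth on $\mathcal D_i$. Notation: for a $b$-tuple $\mathcal S=(\kappa(1),\dots,\kappa(b))$ of elements of $[N]$: $f_{\mathcal S}(x)=\frac1b\sum_j f_{\kappa(j)}(A_{\kappa(j)}x)$, $\nabla f_{\mathcal S}(x)=\frac1b\sum_jA_{\kappa(j)}^\top\nabla f_{\kappa(j)}(A_{\kappa(j)}x)$, $M_{\mathcal S}=\frac1b\sum_j\gamma_{\kappa(j)}A_{\kappa(j)}^\top A_{\kappa(j)}$, $M_N=\frac1N\sum_i\gamma_iA_i^\top A_i$, $\mathcal A_{\mathcal S}=\frac1b(A_{\kappa(1)}^\top,\dots,A_{\kappa(b)}^\top)^\top$,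 $\mathcal D=\prod_j\mathcal D_{\kappa(j)}$, and for $\alpha>0$, $x,v\in\mathbb{R}^n$ the map $\mathcal V=(\mathcal V_1,\dots,\mathcal V_b)$, $\mathcal V_j(\xi)=\nabla\hat f^\ast_{\kappa(j)}(\xi_j)-A_{\kappa(j)}\operatorname{prox}_{\alpha\phi}(x-\alpha\mathcal A_{\mathcal S}^\top\xi+v)$, where $\operatorname{prox}_g(y)=\operatorname{argmin}_wg(w)+\frac12\|y-w\|^2$. Constants: $L$ = Lipschitz constant of $\nabla f$; $\bar L=\max_iL_i\|A_i\|^2$; $\bar A=\max_i\|A_i\|^2$; $\bar M=\max_i\gamma_i\cdot\bar A$; $\mu_\ast=\min_i1/(L_i+\gamma_i)$. $F^\alpha_{\mathrm{nat}}(x)=x-\operatorname{prox}_{\alpha\phi}(x-\alpha\nabla f(x))$, $F_{\mathrm{nat}}=F^1_{\mathrm{nat}}$. Algorithm SNSPP: inputs $\tilde x^0\in\mathbb{R}^n$, $m\in\mathbb N$, $S\in\mathbb N\cup\{\infty\}$, step sizes $\alpha_k^s>0$, batch sizes $b_k^s$, tolerances $\epsilon_k^s\ge0$. For $s=0,1,\dots,S$: set $x^{s,0}=\tilde x^s$; for $k=0,\dots,m-1$: draw a $b_k^s$-tuple $\mathcal S_k^s$ with entries i.i.d. uniform on $[N]$ (with replacement), independent of the past; set $v^{s,k}=\nabla f(\tilde x^s)-\nabla f_{\mathcal S_k^s}(\tilde x^s)$ and $\hat v^{s,k}=\alpha_k^s(v^{s,k}-M_{\mathcal S_k^s}x^{s,k})$;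 compute any $\xi^{s,k+1}\in\mathcal D$ with $\|\mathcal V(\xi^{s,k+1})\|\le\epsilon_k^s$, where $\mathcal V$ uses data $(\mathcal S,\alpha,x,v)=(\mathcal S_k^s,\alpha_k^s,x^{s,k},-\hat v^{s,k})$; set $x^{s,k+1}=\operatorname{prox}_{\alpha_k^s\phi}(x^{s,k}-\alpha_k^s\mathcal A_{\mathcal S_k^s}^\top\xi^{s,k+1}-\hat v^{s,k})$. Then Option I: $\tilde x^{s+1}=x^{s,m}$; Option II: $\tilde x^{s+1}=\frac1m\sum_{k=1}^mx^{s,k}$. Output: $\tilde x^{S+1}$ and $x_\pi$ drawn uniformly from $\{x^{s,k}:0\le k<m,\ 0\le s\le S\}$. *)

(* Defs.v *)
From HB Require Import structures.
From mathcomp Require Import all_boot all_order all_algebra.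
From mathcomp Require Import all_classical all_reals all_analysis.
Set Implicit Arguments. Unset Strict Implicit. Unset Printing Implicit Defensive.
Import Order.TTheory GRing.Theory Num.Theory.
Local Open Scope classical_set_scope.
Local Open Scope ring_scope.

Section Defs.
Context {R : realType}.

Definition dotv n (u v : 'cV[R]_n) : R := \sum_(i < n) u i 0 * v i 0.
Definition enorm n (u : 'cV[R]_n) : R := Num.sqrt (dotv u u).

Definition opnorm p q (A : 'M[R]_(p, q)) : R :=
  sup [set enorm (A *m x) | x in [set x : 'cV[R]_q | enorm x <= 1]].

Definition seq_conv n (u : nat -> 'cV[R]_n) (y : 'cV[R]_n) :=
  forall e, 0 < e -> exists N0, forall k, (N0 <= k)%N -> enorm (u k - y) < e.

Definition has_grad_at n (f : 'cV[R]_n -> R) (g z : 'cV[R]_n) :=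
  forall e, 0 < e -> exists2 d, 0 < d & forall h, enorm h < d ->
    `| f (z + h) - f z - dotv g h | <= e * enorm h.

Definition vcontinuous p q (F : 'cV[R]_p -> 'cV[R]_q) :=
  forall x e, 0 < e -> exists2 d, 0 < d & forall y, enorm (y - x) < d ->
    enorm (F y - F x) < e.

Definition C1_with_grad n (f : 'cV[R]_n -> R) (gf : 'cV[R]_n -> 'cV[R]_n) :=
  (forall z, has_grad_at f (gf z) z) /\ vcontinuous gf.

Definition lipschitz_with p q (F : 'cV[R]_p -> 'cV[R]_q) (L : R) :=
  forall x y, enorm (F x - F y) <= L * enorm (x - y).

Definition L_smooth n (f : 'cV[R]_n -> R) (gf : 'cV[R]_n -> 'cV[R]_n) (L : R) :=
  [/\ 0 <= L, C1_with_grad f gf & lipschitz_with gf L].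

Definition convex_fun n (h : 'cV[R]_n -> R) :=
  forall x y (t : R), 0 <= t <= 1 ->
    h (t *: x + (1 - t) *: y) <= t * h x + (1 - t) * h y.

Definition weakly_convex n (f : 'cV[R]_n -> R) (gam : R) :=
  0 <= gam /\ convex_fun (fun z => f z + gam / 2 * enorm z ^+ 2).

Definition proper_efun n (phi : 'cV[R]_n -> \bar R) :=
  (exists x, (phi x < +oo)%E) /\ (forall x, (-oo < phi x)%E).

Definition lsc_efun n (phi : 'cV[R]_n -> \bar R) :=
  forall x (t : \bar R), (t < phi x)%E ->
    exists2 d, 0 < d & forall y, enorm (y - x) < d -> (t < phi y)%E.

Definition convex_efun n (phi : 'cV[R]_n -> \bar R) :=
  forall x y : 'cV[R]_n, forall t : R, 0 <= t <= 1 ->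
    (phi (t *: x + (1 - t) *: y)%R <= t%:E * phi x + (1 - t)%R%:E * phi y)%E.

Definition is_prox n (phi : 'cV[R]_n -> \bar R) (a : R) (y w : 'cV[R]_n) :=
  forall u, (a%:E * phi w + (enorm (y - w) ^+ 2 / 2)%:E
             <= a%:E * phi u + (enorm (y - u) ^+ 2 / 2)%:E)%E.

Definition conjugate n (h : 'cV[R]_n -> R) (y : 'cV[R]_n) : \bar R :=
  ereal_sup [set (dotv y z - h z)%:E | z in [set: 'cV[R]_n]].

Definition int_dom n (g : 'cV[R]_n -> \bar R) : set 'cV[R]_n :=
  [set y | exists2 r, 0 < r & forall y', enorm (y' - y) < r -> (g y' < +oo)%E].

(** essential differentiability (essential smoothness, Rockafellar Sec. 26)
    of g, whose gradient on int dom g is G *)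
Definition ess_differentiable n (g : 'cV[R]_n -> \bar R) (G : 'cV[R]_n -> 'cV[R]_n) :=
  [/\ exists y, int_dom g y,
      (forall y, int_dom g y -> has_grad_at (fun z => fine (g z)) (G y) y) &
      (forall (u : nat -> 'cV[R]_n) y, (forall k, int_dom g (u k)) ->
          seq_conv u y -> ~ int_dom g y ->
          forall B, exists N0, forall k, (N0 <= k)%N -> B < enorm (G (u k)))].

Definition loc_lipschitz_on p q (F : 'cV[R]_p -> 'cV[R]_q) (D : set 'cV[R]_p) :=
  forall y, D y -> exists r, 0 < r /\ exists K,
    (forall z, enorm (z - y) < r -> D z) /\
    forall u v, enorm (u - y) < r -> enorm (v - y) < r ->
      enorm (F u - F v) <= K * enorm (u - v).

Definition jacobian_at p q (F : 'cV[R]_p -> 'cV[R]_q) (J : 'M[R]_(q, p)) z :=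
  forall e, 0 < e -> exists2 d, 0 < d & forall h, enorm h < d ->
    enorm (F (z + h) - F z - J *m h) <= e * enorm h.

Definition bouligand p q (F : 'cV[R]_p -> 'cV[R]_q) (U : set 'cV[R]_p) z
  : set 'M[R]_(q, p) :=
  [set J | exists (zs : nat -> 'cV[R]_p) (Js : nat -> 'M[R]_(q, p)),
     [/\ forall k, U (zs k) /\ jacobian_at F (Js k) (zs k),
         seq_conv zs z &
         forall e, 0 < e -> exists N0, forall k, (N0 <= k)%N ->
           forall i j, `| Js k i j - J i j | < e]].

Definition clarke p q (F : 'cV[R]_p -> 'cV[R]_q) (U : set 'cV[R]_p) z
  : set 'M[R]_(q, p) :=
  [set J | exists K (lam : 'I_K -> R) (Js : 'I_K -> 'M[R]_(q, p)),
     [/\ forall l, 0 <= lam l, \sum_(l < K) lam l = 1,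
         forall l, bouligand F U z (Js l) &
         J = \sum_(l < K) lam l *: Js l]].

Definition dir_diff_at p q (F : 'cV[R]_p -> 'cV[R]_q) z :=
  forall dr, exists Fd, forall e, 0 < e -> exists2 t0, 0 < t0 &
    forall t, 0 < t < t0 -> enorm (t^-1 *: (F (z + t *: dr) - F z) - Fd) < e.

Definition semismooth_order (nu : R) p q (F : 'cV[R]_p -> 'cV[R]_q)
    (U : set 'cV[R]_p) :=
  forall z, U z ->
  [/\ exists r, 0 < r /\ exists K, forall u v, enorm (u - z) < r ->
        enorm (v - z) < r -> enorm (F u - F v) <= K * enorm (u - v),
      dir_diff_at F z &
      exists C, exists2 d, 0 < d & forall h M, enorm h < d -> U (z + h) ->
        clarke F U (z + h) M ->
        enorm (F (z + h) - F z - M *m h) <= C * (enorm h `^ (1 + nu))].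

Section Problem.
Variables (N n : nat) (mi : 'I_N -> nat) (A : forall i : 'I_N, 'M[R]_(mi i, n)).

Definition fsum (f : forall i : 'I_N, 'cV[R]_(mi i) -> R) (x : 'cV[R]_n) : R :=
  N%:R^-1 * \sum_(i < N) f i (A i *m x).

Definition gradf (gf : forall i : 'I_N, 'cV[R]_(mi i) -> 'cV[R]_(mi i))
  (x : 'cV[R]_n) : 'cV[R]_n :=
  N%:R^-1 *: \sum_(i < N) (A i)^T *m gf i (A i *m x).

Definition fhat (f : forall i : 'I_N, 'cV[R]_(mi i) -> R) (gam : 'I_N -> R)
  (i : 'I_N) (z : 'cV[R]_(mi i)) : R := f i z + gam i / 2 * enorm z ^+ 2.

Variable b : nat.

Definition gradfS (gf : forall i : 'I_N, 'cV[R]_(mi i) -> 'cV[R]_(mi i))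
  (S : 'I_b -> 'I_N) (x : 'cV[R]_n) : 'cV[R]_n :=
  b%:R^-1 *: \sum_(j < b) (A (S j))^T *m gf (S j) (A (S j) *m x).

Definition MS (gam : 'I_N -> R) (S : 'I_b -> 'I_N) : 'M[R]_n :=
  b%:R^-1 *: \sum_(j < b) (gam (S j) *: ((A (S j))^T *m A (S j))).

(** a dual variable xi = (xi_1, ..., xi_b); for convenience xi_j is stored
    as a family over all i, of which only the component xi j (S j) is used *)
Definition dualvar := 'I_b -> forall i : 'I_N, 'cV[R]_(mi i).

Definition AtS (S : 'I_b -> 'I_N) (xi : dualvar) : 'cV[R]_n :=
  b%:R^-1 *: \sum_(j < b) (A (S j))^T *m xi j (S j).

Definition Vnorm (gconj : forall i : 'I_N, 'cV[R]_(mi i) -> 'cV[R]_(mi i))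
  (prox : R -> 'cV[R]_n -> 'cV[R]_n) (S : 'I_b -> 'I_N) (alpha : R)
  (x v : 'cV[R]_n) (xi : dualvar) : R :=
  Num.sqrt (\sum_(j < b)
    enorm (gconj (S j) (xi j (S j))
           - A (S j) *m prox alpha (x - alpha *: AtS S xi + v)) ^+ 2).

End Problem.

Definition max_over N (F : 'I_N -> R) : R := \big[Num.max/0]_(i < N) F i.

Definition iid_uniform d (T : measurableType d) (P : probability T R)
  (I : eqType) (N : nat) (X : I -> T -> 'I_N) :=
  (forall i v, measurable [set w | X i w = v]) /\
  forall (l : seq I) (v : I -> 'I_N), uniq l ->
    P (\bigcap_(i in [set i | i \in l]) [set w | X i w = v i])
      = ((N%:R^-1) ^+ size l)%:E.

Definition history (T : Type) (m b N : nat)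
  (kappa : nat -> 'I_m -> 'I_b -> T -> 'I_N) (s : nat) (k : 'I_m) (w : T)
  : nat -> 'I_m -> 'I_b -> option 'I_N :=
  fun s' k' j => if ((s' < s) || ((s' == s) && (k' <= k)))%N
                 then Some (kappa s' k' j w) else None.

End Defs.

Arguments fhat {R N mi} f gam i z.
Arguments dualvar {R N} mi b.

(* Main.v *)
Require Import Defs.
From HB Require Import structures.
From mathcomp Require Import all_boot all_order all_algebra.
From mathcomp Require Import all_classical all_reals all_analysis.
From mathcomp Require Import measurable_realfun.
From mathcomp Require Import ring lra.
Import Order.TTheory GRing.Theory Num.Theory.
Local Open Scope classical_set_scope.
Local Open Scope ring_scope.

(** Write [t] for the flattened index [s * m + k], [y] for [x_{t+1}], [x] for
    [x_t], [d] for [y - x], and let [Q] be the error of the variance-reduced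
    gradient estimator at [x].  Since the gradient of a conjugate inverts
    [grad fhat_i], the dual iterate consists of values of [grad fhat_i] at points
    close to [A_i y].  Comparing [y] with [x] in the proximal inequality and using
    only monotonicity of [grad fhat_i] gives, up to the tolerance error,
    [psi y <= psi x + <Q, d> + L |d|^2 - |d|^2 / alpha].
    The conditional second moment of [Q] is at most [Lbar^2 / b * |x - xtilde|^2],
    and summing over one stage bounds [E |Q|^2] by [tau^2 E |d|^2] with
    [tau = m Lbar / sqrt (2 b)]; the step size condition yields
    [alpha (L + tau) <= eta < 1], so that the sums of [E |d|^2 / alpha] and of
    [E |Q|^2] are finite.  Hence so is the sum of the expectations of
    [W = |d|^2 / alpha + alpha |Fnat x|^2].  As [|Fnat|^2] changes by at most
    [O(W)] in one step, it converges, both in expectation and along almost every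
    path, and the limit is [0] because the step sizes have infinite sum. *)

Set Implicit Arguments. Unset Strict Implicit. Unset Printing Implicit Defensive.

(** * Euclidean norms *)

Section Euclid.
Context {R : realType}.

Lemma dotvE n (u v : 'cV[R]_n) : dotv u v = (u^T *m v) 0 0.
Proof. by rewrite mxE; apply: eq_bigr => i _; rewrite mxE. Qed.

Lemma dotvC n (u v : 'cV[R]_n) : dotv u v = dotv v u.
Proof. by apply: eq_bigr => i _; rewrite mulrC. Qed.

Lemma dotvDl n (u v w : 'cV[R]_n) : dotv (u + v) w = dotv u w + dotv v w.
Proof. by rewrite !dotvE linearD mulmxDl mxE. Qed.

Lemma dotvZl n a (u w : 'cV[R]_n) : dotv (a *: u) w = a * dotv u w.
Proof. by rewrite !dotvE linearZ -scalemxAl mxE. Qed.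

Lemma dotvNl n (u w : 'cV[R]_n) : dotv (- u) w = - dotv u w.
Proof. by rewrite -scaleN1r dotvZl mulN1r. Qed.

Lemma dotvDr n (u v w : 'cV[R]_n) : dotv w (u + v) = dotv w u + dotv w v.
Proof. by rewrite !(dotvC w) dotvDl. Qed.

Lemma dotvZr n a (u w : 'cV[R]_n) : dotv w (a *: u) = a * dotv w u.
Proof. by rewrite !(dotvC w) dotvZl. Qed.

Lemma dotvNr n (u w : 'cV[R]_n) : dotv w (- u) = - dotv w u.
Proof. by rewrite !(dotvC w) dotvNl. Qed.

Lemma dot0v n (u : 'cV[R]_n) : dotv 0 u = 0.
Proof. by rewrite -(scale0r u) dotvZl mul0r. Qed.

Definition dotv_lin := (dotvDl, dotvDr, dotvNl, dotvNr, dotvZl, dotvZr).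

Lemma dotv_suml n (I : finType) (F : I -> 'cV[R]_n) w :
  dotv (\sum_i F i) w = \sum_i dotv (F i) w.
Proof.
elim/big_rec2: _ => [|i y z _ <-]; last by rewrite dotvDl.
by rewrite dot0v.
Qed.

Lemma dotv_sumr n (I : finType) (F : I -> 'cV[R]_n) w :
  dotv w (\sum_i F i) = \sum_i dotv w (F i).
Proof. by rewrite dotvC dotv_suml; apply: eq_bigr => i _; rewrite dotvC. Qed.

Lemma dotv_mulmx p q (M : 'M[R]_(p, q)) u v : dotv (M^T *m u) v = dotv u (M *m v).
Proof. by rewrite !dotvE trmx_mul trmxK mulmxA. Qed.

Lemma dotv_ge0 n (u : 'cV[R]_n) : 0 <= dotv u u.
Proof. by apply: sumr_ge0 => i _; rewrite -expr2 sqr_ge0. Qed.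

Lemma enorm_ge0 n (u : 'cV[R]_n) : 0 <= enorm u.
Proof. exact: sqrtr_ge0. Qed.
Hint Resolve enorm_ge0 : core.

Lemma enormE n (u : 'cV[R]_n) : enorm u ^+ 2 = dotv u u.
Proof. by rewrite sqr_sqrtr // dotv_ge0. Qed.

Lemma dotv_eq0 n (u : 'cV[R]_n) : dotv u u = 0 -> u = 0.
Proof.
move=> /eqP; rewrite psumr_eq0 => [/allP u0|i _]; last by rewrite -expr2 sqr_ge0.
apply/colP => i; rewrite mxE; apply/eqP.
by have := u0 i (mem_index_enum i); rewrite /= mulf_eq0 orbb.
Qed.

Lemma enorm_eq0 n (u : 'cV[R]_n) : enorm u = 0 -> u = 0.
Proof. by move=> u0; apply: dotv_eq0; rewrite -enormE u0 expr0n. Qed.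

Lemma enorm0 n : enorm (0 : 'cV[R]_n) = 0.
Proof. by rewrite /enorm dot0v sqrtr0. Qed.

Lemma enormZ n a (u : 'cV[R]_n) : enorm (a *: u) = `|a| * enorm u.
Proof. by rewrite /enorm dotvZl dotvZr mulrA -expr2 sqrtrM ?sqr_ge0 // sqrtr_sqr. Qed.

Lemma enormN n (u : 'cV[R]_n) : enorm (- u) = enorm u.
Proof. by rewrite -scaleN1r enormZ normrN1 mul1r. Qed.

Lemma enormB n (u v : 'cV[R]_n) : enorm (u - v) = enorm (v - u).
Proof. by rewrite -opprB enormN. Qed.

(** Cauchy-Schwarz: expand the squared norm of [enorm v *: u - enorm u *: v] and divide by the
    product of the norms. *)
Lemma dotv_le n (u v : 'cV[R]_n) : dotv u v <= enorm u * enorm v.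
Proof.
have [u0|u0] := eqVneq (enorm u) 0.
  by rewrite (enorm_eq0 u0) enorm0 mul0r dot0v.
have [v0|v0] := eqVneq (enorm v) 0.
  by rewrite (enorm_eq0 v0) enorm0 mulr0 dotvC dot0v.
have uv0 : 0 < enorm u * enorm v by rewrite mulr_gt0 // lt0r ?u0 ?v0 enorm_ge0.
have := dotv_ge0 (enorm v *: u - enorm u *: v).
rewrite !dotv_lin -!enormE (dotvC v u) => h.
have : 0 <= (enorm u * enorm v) * (enorm u * enorm v - dotv u v) by nra.
by rewrite pmulr_rge0 // subr_ge0.
Qed.

Lemma dotv_young n (u v : 'cV[R]_n) th : 0 < th ->
  dotv u v <= enorm u ^+ 2 / (2 * th) + th / 2 * enorm v ^+ 2.
Proof.
move=> th0; have := dotv_ge0 (u - th *: v).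
rewrite !dotv_lin -!enormE (dotvC v u) => h.
rewrite -(ler_pM2l (x := 2 * th)) ?mulr_gt0 //.
rewrite mulrDr mulrCA divff ?mulf_neq0 ?pnatr_eq0 ?gt_eqF // mulr1; nra.
Qed.

Lemma enormD n (u v : 'cV[R]_n) : enorm (u + v) <= enorm u + enorm v.
Proof.
rewrite -(ler_pXn2r (n := 2)) ?nnegrE ?addr_ge0 //.
have := dotv_le u v; rewrite sqrrD !enormE !dotv_lin (dotvC v u); lra.
Qed.

Lemma enorm_sum n (I : finType) (F : I -> 'cV[R]_n) :
  enorm (\sum_i F i) <= \sum_i enorm (F i).
Proof.
elim/big_rec2: _ => [|i y z _ h]; first by rewrite enorm0.
by apply: le_trans (enormD _ _) _; rewrite lerD2l.
Qed.

Lemma enorm_dist n (u v : 'cV[R]_n) : `|enorm u - enorm v| <= enorm (u - v).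
Proof.
rewrite ler_norml lerNl opprB !lerBlDl; apply/andP; split.
  by rewrite enormB addrC -lerBlDr -{1}(subrK u v) lerBlDr enormD.
by rewrite addrC -lerBlDr -{1}(subrK v u) lerBlDr enormD.
Qed.

Lemma sqr_sum_le (I : finType) (F : I -> R) :
  (\sum_i F i) ^+ 2 <= #|I|%:R * \sum_i F i ^+ 2.
Proof.
rewrite expr2 mulr_suml.
under eq_bigr do rewrite mulr_sumr.
apply: (@le_trans _ _ (\sum_i \sum_j (F i ^+ 2 + F j ^+ 2) / 2)).
  by apply: ler_sum => i _; apply: ler_sum => j _; have := sqr_ge0 (F i - F j); nra.
under eq_bigr do rewrite -mulr_suml big_split /= sumr_const.
rewrite -mulr_suml big_split /= sumr_const sumrMnl -mulr_natl.
by rewrite le_eqVlt; apply/orP; left; apply/eqP; field.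
Qed.

Lemma enorm_sum_sqr n (I : finType) (F : I -> 'cV[R]_n) :
  enorm (\sum_i F i) ^+ 2 <= #|I|%:R * \sum_i enorm (F i) ^+ 2.
Proof.
apply: le_trans (sqr_sum_le _); rewrite ler_pXn2r ?nnegrE ?sumr_ge0 //.
exact: enorm_sum.
Qed.

(** [sup] is meaningful only for nonempty sets bounded above. The sum of the column norms is a
    bound, as each coordinate of a vector in the unit ball has absolute value at most [1]. *)
Lemma opnorm_has_sup p q (M : 'M[R]_(p, q)) :
  has_sup [set enorm (M *m x) | x in [set x : 'cV[R]_q | enorm x <= 1]].
Proof.
split; first by exists (enorm (M *m 0)), 0 => //=; rewrite enorm0.
exists (\sum_j enorm (col j M)) => _ [x /= x1 <-].
have -> : M *m x = \sum_j x j 0 *: col j M.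
  apply/colP => i; rewrite mxE summxE; apply: eq_bigr => j _.
  by rewrite !mxE mulrC.
apply: le_trans (enorm_sum _) _; apply: ler_sum => j _; rewrite enormZ.
rewrite ler_piMl //; apply: le_trans x1.
rewrite -(ler_pXn2r (n := 2)) ?nnegrE // enormE real_normK ?num_real //.
rewrite /dotv (bigD1 j) //= -expr2 lerDl sumr_ge0 // => i _.
by rewrite -expr2 sqr_ge0.
Qed.

Lemma opnorm_ge0 p q (M : 'M[R]_(p, q)) : 0 <= opnorm M.
Proof.
apply: (@le_trans _ _ (enorm (M *m 0))) => //; apply: sup_upper_bound.
  exact: opnorm_has_sup.
by exists 0 => //=; rewrite enorm0.
Qed.

Lemma opnorm_le p q (M : 'M[R]_(p, q)) x : enorm (M *m x) <= opnorm M * enorm x.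
Proof.
have [x0|x0] := eqVneq (enorm x) 0.
  by rewrite (enorm_eq0 x0) mulmx0 !enorm0 mulr0.
have xp : 0 < enorm x by rewrite lt0r x0 enorm_ge0.
rewrite -ler_pdivrMr //.
have -> : enorm (M *m x) / enorm x = enorm (M *m ((enorm x)^-1 *: x)).
  by rewrite -scalemxAr enormZ ger0_norm ?invr_ge0 // mulrC.
apply: sup_upper_bound; first exact: opnorm_has_sup.
exists ((enorm x)^-1 *: x) => //=.
by rewrite enormZ ger0_norm ?invr_ge0 // mulVf.
Qed.

Lemma opnorm_tr_le p q (M : 'M[R]_(p, q)) y :
  enorm (M^T *m y) <= opnorm M * enorm y.
Proof.
have [x0|x0] := eqVneq (enorm (M^T *m y)) 0.
  by rewrite x0 mulr_ge0 // opnorm_ge0.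
have xp : 0 < enorm (M^T *m y) by rewrite lt0r x0 enorm_ge0.
rewrite -(ler_pM2r xp) -expr2 enormE dotv_mulmx.
apply: le_trans (dotv_le _ _) _.
by rewrite mulrC mulrAC ler_wpM2r // opnorm_le.
Qed.

End Euclid.
#[global] Hint Extern 0 (is_true (0 <= enorm _)) => exact: enorm_ge0 : core.
#[global] Hint Extern 0 (is_true (0 <= opnorm _)) => exact: opnorm_ge0 : core.
#[global] Hint Extern 0 (is_true (0 <= dotv _ _)) => exact: dotv_ge0 : core.

(** * Gradients, conjugates and proximal maps *)

Section Gradient.
Import numFieldNormedType.Exports.
Context {R : realType}.

(** Passage to the limit in estimates with an arbitrary [e]; the choice [e / (c + 1)] covers
    [c = 0]. *)
Lemma le_eps_mul (x c : R) : 0 <= c -> (forall e, 0 < e -> x <= e * c) -> x <= 0.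
Proof.
move=> c0 h; apply/ler_addgt0Pl => e e0; rewrite addr0.
apply: le_trans (h (e / (c + 1)) _) _; first by rewrite divr_gt0 // ltr_wpDl ?ltr01.
by rewrite mulrAC ler_pdivrMr ?ltr_wpDl ?ltr01 // ler_pM2l // lerDl.
Qed.

Lemma small_step n (d : 'cV[R]_n) (r : R) : 0 < r ->
  exists t, [/\ 0 < t, t <= 1 & enorm (t *: d) < r].
Proof.
move=> r0; have dp : 0 < enorm d + 1 by rewrite ltr_wpDl ?ltr01.
pose t := Num.min 1 (r / (2 * (enorm d + 1))).
have t0 : 0 < t by rewrite /t lt_min ltr01 /= divr_gt0 // mulr_gt0 // ltr0n.
exists t; split => //; first by rewrite ge_min lexx.
rewrite enormZ gtr0_norm //.
apply: (@le_lt_trans _ _ (r / (2 * (enorm d + 1)) * enorm d)).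
  by rewrite ler_wpM2r // ge_min lexx orbT.
rewrite mulrAC ltr_pdivrMr ?mulr_gt0 // ltr_pM2l //.
have := enorm_ge0 d; lra.
Qed.

(** The first-order expansion at [x + t (u - x)] is compared with the chord and divided by [t].
    Convexity is asked on one segment only, so that [h] may be the [fine] part of a conjugate, which
    is [0] where the conjugate is infinite. *)
Lemma convex_subgrad n (h : 'cV[R]_n -> R) g x u :
  has_grad_at h g x ->
  (forall t, 0 <= t <= 1 -> h (x + t *: (u - x)) <= (1 - t) * h x + t * h u) ->
  h x + dotv g (u - x) <= h u.
Proof.
move=> hg hc; rewrite -subr_le0; apply: (@le_eps_mul _ (enorm (u - x))) => // e e0.
have [r r0 hr] := hg e e0.
have [t [t0 t1 tr]] := small_step (u - x) r0.
have {hr} := hr _ tr; rewrite ler_norml => /andP[h1 _].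
have {hc} := hc t; rewrite (ltW t0) t1 => /(_ isT) h2.
move: h1; rewrite enormZ gtr0_norm // dotvZr => h1.
rewrite -(ler_pM2l t0); lra.
Qed.

Lemma convex_fun_segment n (h : 'cV[R]_n -> R) x u : convex_fun h ->
  forall t, 0 <= t <= 1 -> h (x + t *: (u - x)) <= (1 - t) * h x + t * h u.
Proof.
move=> hc t t01; have -> : x + t *: (u - x) = t *: u + (1 - t) *: x.
  by rewrite scalerBr scalerBl scale1r addrCA.
by apply: le_trans (hc _ _ _ t01) _; rewrite addrC.
Qed.

Lemma grad_monotone n (h : 'cV[R]_n -> R) gh u v :
  (forall z, has_grad_at h (gh z) z) -> convex_fun h ->
  0 <= dotv (gh u - gh v) (u - v).
Proof.
move=> hg hc.
have := convex_subgrad (hg u) (convex_fun_segment u v hc).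
have := convex_subgrad (hg v) (convex_fun_segment v u hc).
rewrite !dotv_lin; lra.
Qed.

(** Since [h - <xi, .>] is minimal at [z], a short move along [xi - g] cannot decrease it to first
    order, which forces [|xi - g|^2 <= 0]. *)
Lemma grad_minimizer n (h : 'cV[R]_n -> R) g z xi :
  has_grad_at h g z -> (forall u, h z + dotv xi (u - z) <= h u) -> xi = g.
Proof.
move=> hg hm; apply/eqP; rewrite -subr_eq0; apply/eqP/dotv_eq0/eqP.
rewrite eq_le dotv_ge0 andbT.
apply: (@le_eps_mul _ (enorm (xi - g))) => // e e0.
have [r r0 hr] := hg e e0.
have [t [t0 t1 tr]] := small_step (xi - g) r0.
have {hr} := hr _ tr; rewrite ler_norml => /andP[_ h1].
have := hm (z + t *: (xi - g)); rewrite (addrC z) addrK => h2.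
move: h1 h2; rewrite enormZ gtr0_norm // (addrC z) !dotvZr dotvDl dotvNl => h1 h2.
rewrite -(ler_pM2l t0); lra.
Qed.

Lemma conjugate_le n (h : 'cV[R]_n -> R) y c :
  (conjugate h y <= c%:E)%E <-> forall z, dotv y z - h z <= c.
Proof.
split=> [hc z|hc].
  by rewrite -lee_fin; apply: le_trans hc; apply: ereal_sup_ubound; exists z.
by apply: ub_ereal_sup => _ [z _ <-]; rewrite lee_fin.
Qed.

Lemma conjugate_fine n (h : 'cV[R]_n -> R) y : (conjugate h y < +oo)%E ->
  conjugate h y = (fine (conjugate h y))%:E.
Proof.
move=> hy; rewrite fineK // fin_numE -ltNye -ltey hy andbT.
by apply: lt_le_trans (ltNyr _) (ereal_sup_ubound _); exists 0.
Qed.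

(* z is the maximizer of <xi, .> - h: convexity of the conjugate gives
   h^*(y) >= h^*(xi) + <z, y - xi>, and it suffices to take y = gh z. *)
Lemma conjugate_grad n (h : 'cV[R]_n -> R) gh z xi :
  (forall u, has_grad_at h (gh u) u) -> convex_fun h ->
  int_dom (conjugate h) xi ->
  has_grad_at (fun y => fine (conjugate h y)) z xi -> xi = gh z.
Proof.
move=> hg hc [r r0 hr] hz.
have {r r0 hr} xifin : (conjugate h xi < +oo)%E.
  by apply: hr; rewrite subrr enorm0.
have sub u v : h u + dotv (gh u) (v - u) <= h v.
  exact: convex_subgrad (hg u) (convex_fun_segment u v hc).
set y0 := gh z.
have cy0 : (conjugate h y0 <= (dotv y0 z - h z)%:E)%E.
  by apply/conjugate_le => v; have := sub z v; rewrite dotvDr dotvNr; lra.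
have y0fin : (conjugate h y0 < +oo)%E by apply: le_lt_trans cy0 (ltry _).
move: cy0; rewrite (conjugate_fine y0fin) lee_fin => cy0.
have bnd y v : (conjugate h y < +oo)%E -> dotv y v - h v <= fine (conjugate h y).
  by move=> /conjugate_fine yf; move: v; apply/conjugate_le; rewrite -yf.
have := @convex_subgrad _ _ _ _ y0 hz.
have seg : (forall t, 0 <= t <= 1 -> fine (conjugate h (xi + t *: (y0 - xi))) <=
    (1 - t) * fine (conjugate h xi) + t * fine (conjugate h y0)).
  move=> t /andP[t0 t1].
  have le_t : (conjugate h (xi + t *: (y0 - xi)) <= ((1 - t) * fine (conjugate h xi) +
      t * fine (conjugate h y0))%:E)%E.
    apply/conjugate_le => v; have := bnd _ v xifin; have := bnd _ v y0fin.
    rewrite !dotv_lin => h1 h2; have t1' : 0 <= 1 - t by lra.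
    have := ler_wpM2l t0 h1; have := ler_wpM2l t1' h2; lra.
  have tfin := le_lt_trans le_t (ltry _).
  by move: le_t; rewrite (conjugate_fine tfin) lee_fin.
move=> /(_ seg) key.
(* By [key] and [cy0], [h^*(xi) <= <xi, z> - h z], whereas [<xi, u> - h u <= h^*(xi)] for every [u];
   hence [z] minimizes [h - <xi, .>]. *)
apply: grad_minimizer (hg z) _ => u; have := bnd _ u xifin.
move: key; rewrite !dotv_lin (dotvC z y0) (dotvC z xi); lra.
Qed.

Lemma has_gradD n (h1 h2 : 'cV[R]_n -> R) g1 g2 z :
  has_grad_at h1 g1 z -> has_grad_at h2 g2 z ->
  has_grad_at (fun x => h1 x + h2 x) (g1 + g2) z.
Proof.
move=> H1 H2 e e0; have e2 : 0 < e / 2 by lra.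
have [r1 r10 {}H1] := H1 _ e2; have [r2 r20 {}H2] := H2 _ e2.
exists (Num.min r1 r2) => [|d]; first by rewrite lt_min r10.
rewrite lt_min => /andP[/H1 k1 /H2 k2]; rewrite dotvDl.
apply: le_trans (_ : _ <= e / 2 * enorm d + e / 2 * enorm d) _; last by lra.
apply: le_trans (lerD k1 k2); apply: le_trans (ler_normD _ _).
by rewrite le_eqVlt; apply/orP; left; apply/eqP; congr (`|_|); ring.
Qed.

Lemma has_gradZ n (h : 'cV[R]_n -> R) g z a :
  has_grad_at h g z -> has_grad_at (fun x => a * h x) (a *: g) z.
Proof.
move=> H e e0; have a1 : 0 < `|a| + 1 by rewrite ltr_wpDl ?ltr01.
have [r r0 {}H] := H (e / (`|a| + 1)) (divr_gt0 e0 a1).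
exists r => // d /H k; rewrite dotvZl -!mulrBr normrM.
apply: le_trans (_ : _ <= `|a| * (e / (`|a| + 1) * enorm d)) _.
  by rewrite ler_wpM2l.
rewrite mulrA ler_wpM2r // mulrA ler_pdivrMr // mulrC ler_pM2l // lerDl.
exact: ler01.
Qed.

Lemma has_grad_sum n (I : finType) (h : I -> 'cV[R]_n -> R) g z :
  (forall i, has_grad_at (h i) (g i) z) ->
  has_grad_at (fun x => \sum_i h i x) (\sum_i g i) z.
Proof.
move=> H; elim: (index_enum I) => [|i s IH].
  rewrite big_nil => e e0; exists 1 => // d _; rewrite !big_nil.
  by rewrite dot0v !subr0 normr0 mulr_ge0 // ltW.
rewrite big_cons.
have -> : (fun x => \sum_(j <- i :: s) h j x) = fun x => h i x + \sum_(j <- s) h j x.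
  by apply/funext => x; rewrite big_cons.
exact: has_gradD.
Qed.

Lemma has_grad_comp p q (M : 'M[R]_(p, q)) (h : 'cV[R]_p -> R) g z :
  has_grad_at h g (M *m z) -> has_grad_at (fun x => h (M *m x)) (M^T *m g) z.
Proof.
move=> H e e0; have M1 : 0 < opnorm M + 1 by rewrite ltr_wpDl ?ltr01.
have [r r0 {}H] := H (e / (opnorm M + 1)) (divr_gt0 e0 M1).
exists (r / (opnorm M + 1)) => [|d]; first exact: divr_gt0.
rewrite ltr_pdivlMr // => dr.
have Md : enorm (M *m d) <= enorm d * (opnorm M + 1).
  rewrite mulrC; apply: le_trans (opnorm_le _ _) _.
  by rewrite ler_wpM2r // lerDl ler01.
have {H} := H _ (le_lt_trans Md dr).
rewrite dotv_mulmx mulmxDr => k; apply: le_trans k _.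
by rewrite mulrAC ler_pdivrMr // -mulrA ler_pM2l.
Qed.

Lemma has_grad_sqr n (z : 'cV[R]_n) c :
  has_grad_at (fun x => c / 2 * enorm x ^+ 2) (c *: z) z.
Proof.
have -> : c *: z = (c / 2) *: (2 *: z) by rewrite scalerA divfK // pnatr_eq0.
apply: has_gradZ => e e0; exists e => // d de.
rewrite !enormE !dotv_lin (dotvC d z).
rewrite (_ : _ - _ - _ = enorm d ^+ 2); last by rewrite enormE; ring.
by rewrite ger0_norm ?sqr_ge0 // expr2 ler_wpM2r // ltW.
Qed.

(** Restriction to a line turns the gradient into a one-variable derivative, to which the mean value
    theorem applies. *)
Lemma has_grad_derive n (h : 'cV[R]_n -> R) g z d (t : R) :
  has_grad_at h g (z + t *: d) ->
  is_derive t 1 (fun s : R => h (z + s *: d)) (dotv g d).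
Proof.
move=> H; have cv : (fun s : R => s^-1 *: (h (z + (s * 1 + t) *: d) - h (z + t *: d)))
    @ 0^' --> dotv g d.
  apply/cvgrPdist_le => e e0.
  have d1 : 0 < enorm d + 1 by rewrite ltr_wpDl ?ltr01.
  have [r r0 {}H] := H (e / (enorm d + 1)) (divr_gt0 e0 d1).
  have rd : 0 < r / (enorm d + 1) by rewrite divr_gt0.
  near=> s.
  have s0 : s != 0 by near: s; exact: nbhs_dnbhs_neq.
  have sr : `|s| < r / (enorm d + 1) by near: s; exact: dnbhs0_lt.
  have sd : enorm (s *: d) < r.
    rewrite enormZ; apply: le_lt_trans (_ : _ <= `|s| * (enorm d + 1)) _.
      by rewrite ler_wpM2l // lerDl ler01.
    by rewrite -ltr_pdivlMr.
  have {H} := H _ sd.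
  have -> : z + t *: d + s *: d = z + (s * 1 + t) *: d.
    by rewrite -addrA -scalerDl (addrC t) mulr1.
  rewrite dotvZr enormZ => k.
  rewrite -(ler_pM2l (x := `|s|)) ?normr_gt0 // -normrM mulrBr /GRing.scale /=.
  rewrite mulrA divff // mul1r distrC; apply: le_trans k _.
  by rewrite mulrCA ler_wpM2l // mulrAC ler_pdivrMr // ler_pM2l // lerDl ler01.
apply: DeriveDef; first by apply/cvg_ex; exists (dotv g d).
exact/cvg_lim.
Unshelve. all: by end_near.
Qed.

Lemma grad_mean_value n (h : 'cV[R]_n -> R) gh z d :
  (forall u, has_grad_at h (gh u) u) ->
  exists2 t, 0 <= t <= 1 & h (z + d) - h z = dotv (gh (z + t *: d)) d.
Proof.
move=> H; have dH t := has_grad_derive (H (z + t *: d)).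
have [|t t01] := MVT_segment ler01 (fun t _ => dH t).
  by apply: derivable_within_continuous => t _; exact: ex_derive.
rewrite scale1r scale0r addr0 subr0 mulr1 => e; rewrite in_itv in t01.
exact: (ex_intro2 _ _ t t01 e).
Qed.

(* The optimal constant is L / 2; the mean value theorem alone gives L, which
   the step size condition can afford. *)
Lemma lipschitz_grad_descent n (h : 'cV[R]_n -> R) gh L z d :
  (forall u, has_grad_at h (gh u) u) -> 0 <= L -> lipschitz_with gh L ->
  h (z + d) <= h z + dotv (gh z) d + L * enorm d ^+ 2.
Proof.
move=> H L0 Lip; have [t /andP[t0 t1] e] := grad_mean_value z d H.
have -> : h (z + d) = h z + dotv (gh z) d + dotv (gh (z + t *: d) - gh z) d.
  by rewrite -(subrK (h z) (h (z + d))) e dotvDl dotvNl; ring.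
rewrite lerD2l; apply: le_trans (dotv_le _ _) _.
rewrite expr2 mulrA ler_wpM2r //; apply: le_trans (Lip _ _) _.
by rewrite ler_wpM2l // (addrC z) addrK enormZ ger0_norm // ler_piMl.
Qed.

End Gradient.

(** * Proximal maps of proper convex functions *)

Section Prox.
Context {R : realType}.
Variables (n : nat) (phi : 'cV[R]_n -> \bar R).
Hypotheses (phi_proper : proper_efun phi) (phi_convex : convex_efun phi).

Lemma proper_fineK u : (phi u < +oo)%E -> phi u = (fine (phi u))%:E.
Proof. by move=> h; rewrite fineK // fin_numE -ltNye -ltey h phi_proper.2. Qed.

Lemma prox_finite a y w : 0 < a -> is_prox phi a y w -> (phi w < +oo)%E.
Proof.
move=> a0 /[dup] hw; have [[u uf] phiN] := phi_proper.
move=> /(_ u); rewrite (proper_fineK uf) -EFinM -EFinD => h.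
rewrite ltey; apply/eqP => wy; move: h.
by rewrite wy gt0_muley ?lte_fin // addye // leNgt ltry.
Qed.

(** This says that [(y - w) / a] is a subgradient of [phi] at [w]. Minimality of [w] is tested
    against [t u + (1 - t) w], and the result is divided by [t]. *)
Lemma prox_subgrad a y w u : 0 < a -> is_prox phi a y w -> (phi u < +oo)%E ->
  a * fine (phi w) + dotv (y - w) (u - w) <= a * fine (phi u).
Proof.
move=> a0 hw uf; have wf := prox_finite a0 hw.
rewrite -subr_le0; apply: (@le_eps_mul _ _ (enorm (u - w) ^+ 2)) => [|e e0].
  exact: sqr_ge0.
(* With [t <= 2 e] the quadratic remainder [t^2 |u - w|^2 / 2] is at most [t e |u - w|^2]. *)
pose t := Num.min 1 (2 * e).
have t0 : 0 < t by rewrite /t lt_min ltr01 mulr_gt0.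
have t1 : t <= 1 by rewrite ge_min lexx.
have te : t <= 2 * e by rewrite ge_min lexx orbT.
have := @phi_convex u w t; rewrite (ltW t0) t1 => /(_ isT).
rewrite (proper_fineK uf) (proper_fineK wf) -!EFinM -EFinD => cv.
have vf := le_lt_trans cv (ltry _).
move: cv; rewrite (proper_fineK vf) lee_fin => cv.
have := hw (t *: u + (1 - t) *: w).
rewrite (proper_fineK vf) (proper_fineK wf) -!EFinM -!EFinD lee_fin !enormE.
have -> : y - (t *: u + (1 - t) *: w) = (y - w) - t *: (u - w).
  by apply/colP => i; rewrite !mxE; ring.
move: (y - w) (u - w) => {hw} q v; rewrite !dotv_lin (dotvC v q) => hw.
have := ler_wpM2l (ltW a0) cv => cv'.
rewrite -(ler_pM2l t0).
have : t * (t * dotv v v) <= t * (2 * e * dotv v v).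
  by rewrite ler_pM2l // ler_wpM2r.
lra.
Qed.

(** Adding the two subgradient inequalities cancels [phi] and gives
    [|w1 - w2|^2 <= <y1 - y2, w1 - w2>]; Cauchy-Schwarz finishes. *)
Lemma prox_firm a y1 w1 y2 w2 : 0 < a ->
  is_prox phi a y1 w1 -> is_prox phi a y2 w2 ->
  enorm (w1 - w2) <= enorm (y1 - y2).
Proof.
move=> a0 h1 h2.
have := prox_subgrad a0 h1 (prox_finite a0 h2).
have := prox_subgrad a0 h2 (prox_finite a0 h1).
move=> k1 k2.
have k : enorm (w1 - w2) ^+ 2 <= dotv (y1 - y2) (w1 - w2).
  rewrite enormE; move: k1 k2; rewrite !dotv_lin (dotvC w2 w1); lra.
have [->//|w0] := eqVneq (enorm (w1 - w2)) 0.
have wp : 0 < enorm (w1 - w2) by rewrite lt0r w0 enorm_ge0.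
rewrite -(ler_pM2r wp) -expr2; apply: le_trans k _; exact: dotv_le.
Qed.

(** Weighting the optimality of [w1] by [a] and adding that of [wa] cancels [phi] and [g]. With [u],
    [v] the norms of the two residuals, Cauchy-Schwarz leaves [(u - v) (a u - v) <= 0]. Because
    [a <= 1], [v < a u] would make both factors positive. *)
Lemma prox_residual_le a x g w1 wa : 0 < a -> a <= 1 ->
  is_prox phi 1 (x - g) w1 -> is_prox phi a (x - a *: g) wa ->
  a * enorm (x - w1) <= enorm (x - wa).
Proof.
move=> a0 a1 h1 ha.
have := prox_subgrad ltr01 h1 (prox_finite a0 ha).
have := prox_subgrad a0 ha (prox_finite ltr01 h1).
set F1 := x - w1; set Fa := x - wa.
have -> : x - a *: g - wa = Fa - a *: g by rewrite /Fa addrAC.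
have -> : x - g - w1 = F1 - g by rewrite /F1 addrAC.
have -> : w1 - wa = Fa - F1 by apply/colP => i; rewrite /Fa /F1 !mxE; ring.
have -> : wa - w1 = F1 - Fa by apply/colP => i; rewrite /Fa /F1 !mxE; ring.
rewrite !mul1r => k1 k2; clearbody F1 Fa.
have := dotv_le F1 Fa.
have F10 := enorm_ge0 F1; have Fa0 := enorm_ge0 Fa.
have {k2} := ler_wpM2l (ltW a0) k2.
move: k1; rewrite !dotv_lin (dotvC Fa F1) (dotvC g F1) -!enormE.
move: (dotv F1 Fa) (dotv _ _) (dotv _ _) (enorm F1) (enorm Fa) F10 Fa0.
move=> c p q u v u0 v0 h k cuv.
have key : (u - v) * (a * u - v) <= 0 by nra.
rewrite leNgt; apply/negP => vau; have uv : v < u by nra.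
have : 0 < (u - v) * (a * u - v) by rewrite mulr_gt0 // subr_gt0.
lra.
Qed.

End Prox.

(** * One step of the algorithm *)

Section Sampling.
Context {R : realType}.
Variables N b : nat.
Implicit Types F G : 'I_N -> R.

(** Independence of two draws in finite form: the sum over all tuples factors into a product over
    the positions, and the factor at [j] vanishes. *)
Lemma sum_ffun_pair0 F G (j j' : 'I_b) : j != j' -> \sum_i F i = 0 ->
  \sum_(S : {ffun 'I_b -> 'I_N}) F (S j) * G (S j') = 0.
Proof.
move=> jj' F0.
pose H l i := (if l == j then F i else 1) * (if l == j' then G i else 1).
transitivity (\prod_l \sum_i H l i); last first.
  by rewrite (bigD1 j) //= /H eqxx (negPf jj'); under eq_bigr do rewrite mulr1;
     rewrite F0 mul0r.
rewrite bigA_distr_bigA; apply: eq_bigr => S _; rewrite /H big_split /=.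
by congr (_ * _); rewrite -big_mkcond /= big_pred1_eq.
Qed.

Lemma sum_ffun_single F (j : 'I_b) :
  \sum_(S : {ffun 'I_b -> 'I_N}) F (S j) = N%:R ^+ b.-1 * \sum_i F i.
Proof.
pose H l i := if l == j then F i else 1.
transitivity (\prod_l \sum_i H l i).
  rewrite bigA_distr_bigA; apply: eq_bigr => S _.
  by rewrite /H -big_mkcond /= big_pred1_eq.
rewrite (bigD1 j) //= /H eqxx mulrC; congr (_ * _).
under eq_bigr => l lj do rewrite (negPf lj) sumr_const card_ord.
by rewrite prodr_const cardC1 card_ord.
Qed.

(** The left side is the expectation over all [b]-tuples. After centring, the cross terms vanish and
    [b] equal diagonal terms remain, against a factor [1 / b^2]. *)
Lemma sample_variance n (z : 'I_N -> 'cV[R]_n) : (0 < N)%N -> (0 < b)%N ->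
  N%:R^-1 ^+ b * \sum_(S : {ffun 'I_b -> 'I_N})
    enorm (N%:R^-1 *: \sum_i z i - b%:R^-1 *: \sum_j z (S j)) ^+ 2
  <= b%:R^-1 * (N%:R^-1 * \sum_i enorm (z i) ^+ 2).
Proof.
move=> N0 b0; have N0' : N%:R != 0 :> R by rewrite pnatr_eq0 -lt0n.
have b0' : b%:R != 0 :> R by rewrite pnatr_eq0 -lt0n.
set zb := N%:R^-1 *: \sum_i z i; pose eta i := zb - z i.
have eta0 : \sum_i eta i = 0.
  rewrite sumrB sumr_const card_ord -scaler_nat /zb scalerA divff // scale1r.
  by rewrite subrr.
(* The variance is at most the second moment; the difference is [<zb, sum_i z_i> = N |zb|^2]. *)
have eta_le : \sum_i dotv (eta i) (eta i) <= \sum_i enorm (z i) ^+ 2.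
  have -> : \sum_i dotv (eta i) (eta i) = \sum_i (- dotv (eta i) (z i)).
    transitivity (dotv (\sum_i eta i) zb + \sum_i (- dotv (eta i) (z i))).
      rewrite dotv_suml -big_split; apply: eq_bigr => i _.
      by rewrite {2}/eta dotvDr dotvNr.
    by rewrite eta0 dot0v add0r.
  have -> : \sum_i enorm (z i) ^+ 2
      = \sum_i (- dotv (eta i) (z i)) + dotv zb (\sum_i z i).
    rewrite dotv_sumr -big_split; apply: eq_bigr => i _ /=.
    by rewrite /eta enormE dotvDl dotvNl; ring.
  by rewrite lerDl {1}/zb dotvZl mulr_ge0 // invr_ge0.
have Qe (S : {ffun 'I_b -> 'I_N}) :
    zb - b%:R^-1 *: \sum_j z (S j) = b%:R^-1 *: \sum_j eta (S j).
  rewrite /eta sumrB sumr_const card_ord -[zb *+ b]scaler_nat scalerBr scalerA mulVf //.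
  by rewrite scale1r.
have cross j j' : \sum_(S : {ffun 'I_b -> 'I_N}) dotv (eta (S j)) (eta (S j')) =
    if j == j' then N%:R ^+ b.-1 * \sum_i dotv (eta i) (eta i) else 0.
  case: eqP => [->|/eqP jj'].
    by rewrite (sum_ffun_single (fun i => dotv (eta i) (eta i))).
  rewrite exchange_big /= big1 // => c _.
  apply: (sum_ffun_pair0 (F := fun i => eta i c 0) (fun i => eta i c 0)) => //.
  by rewrite -summxE eta0 mxE.
have -> : \sum_(S : {ffun 'I_b -> 'I_N})
      enorm (zb - b%:R^-1 *: \sum_j z (S j)) ^+ 2
    = b%:R^-1 ^+ 2 * (\sum_(j < b) N%:R ^+ b.-1 * \sum_i dotv (eta i) (eta i)).
  under eq_bigr => S _ do rewrite Qe enormZ exprMn real_normK ?num_real //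
    enormE dotv_suml.
  rewrite -mulr_sumr; congr (_ * _); rewrite exchange_big /=.
  apply: eq_bigr => j _; under eq_bigr do rewrite dotv_sumr.
  rewrite exchange_big /=; under eq_bigr do rewrite cross.
  by rewrite -big_mkcond /= (big_pred1 j) // => i; rewrite eq_sym.
rewrite sumr_const card_ord -[(_ * _) *+ b]mulr_natl.
have -> : N%:R^-1 ^+ b * (b%:R^-1 ^+ 2 * (b%:R * (N%:R ^+ b.-1 *
      \sum_i dotv (eta i) (eta i)))) =
    b%:R^-1 * (N%:R^-1 * \sum_i dotv (eta i) (eta i)).
  have : N%:R^-1 ^+ b * N%:R ^+ b.-1 = N%:R^-1 :> R.
    by rewrite -{1}(prednK b0) exprS -mulrA -exprMn mulVf // expr1n mulr1.
  move=> e; rewrite -{2}e; field; exact: b0'.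
by rewrite !ler_pM2l // invr_gt0 ltr0n.
Qed.

End Sampling.

(** * Descent and residual estimates for one iteration *)

Section Step.
Unset Implicit Arguments.
Context {R : realType}.
Variables (N n : nat) (mi : 'I_N -> nat) (A : forall i : 'I_N, 'M[R]_(mi i, n)).
Variables (f : forall i : 'I_N, 'cV[R]_(mi i) -> R).
Variables (gf : forall i : 'I_N, 'cV[R]_(mi i) -> 'cV[R]_(mi i)).
Variables (Li gam : 'I_N -> R) (phi : 'cV[R]_n -> \bar R).
Variables (prox : R -> 'cV[R]_n -> 'cV[R]_n).
Variables (gconj : forall i : 'I_N, 'cV[R]_(mi i) -> 'cV[R]_(mi i)).
Variables (L : R) (b : nat).
Hypotheses (N0 : (0 < N)%N) (b0 : (0 < b)%N).
Hypothesis smooth : forall i, L_smooth (f i) (gf i) (Li i).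
Hypothesis wconvex : forall i, weakly_convex (f i) (gam i).
Hypotheses (phi_proper : proper_efun phi) (phi_convex : convex_efun phi).
Hypothesis proxP : forall a y, 0 < a -> is_prox phi a y (prox a y).
Hypotheses (L0 : 0 <= L) (gradf_lip : lipschitz_with (gradf A gf) L).
Hypothesis conj_diff : forall i,
  ess_differentiable (conjugate (fhat f gam i)) (gconj i).

Definition ghat i z := gf i z + gam i *: z.

Set Implicit Arguments.

Let Li0 i : 0 <= Li i. Proof. by case: (smooth i). Qed.
Let gam0 i : 0 <= gam i. Proof. by case: (wconvex i). Qed.

Lemma ghat_grad i z : has_grad_at (fhat f gam i) (ghat i z) z.
Proof.
by apply: has_gradD; [have [_ []] := smooth i | exact: has_grad_sqr].
Qed.

Lemma fhat_convex i : convex_fun (fhat f gam i).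
Proof. by case: (wconvex i). Qed.

Lemma ghat_lip i : lipschitz_with (ghat i) (Li i + gam i).
Proof.
move=> u v; have [_ _ lip] := smooth i.
have -> : ghat i u - ghat i v = (gf i u - gf i v) + gam i *: (u - v).
  by apply/colP => c; rewrite !mxE; ring.
apply: le_trans (enormD _ _) _; rewrite mulrDl lerD //.
by rewrite enormZ ger0_norm.
Qed.

Lemma fsum_grad z : has_grad_at (fsum A f) (gradf A gf z) z.
Proof.
apply: has_gradZ; apply: has_grad_sum => i; apply: has_grad_comp.
by have [_ []] := smooth i.
Qed.

Definition residual y := y - prox 1 (y - gradf A gf y).

Lemma residual_lip : lipschitz_with residual (2 + L).
Proof.
move=> u v; rewrite /residual.
set pu := prox 1 _; set pv := prox 1 _.
have -> : u - pu - (v - pv) = (u - v) - (pu - pv).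
  by apply/colP => c; rewrite !mxE; ring.
apply: le_trans (enormD _ _) _; rewrite enormN.
have h : enorm (pu - pv) <= enorm (u - v) + L * enorm (u - v).
  have := prox_firm phi_proper phi_convex ltr01
    (proxP _ (u - gradf A gf u) ltr01) (proxP _ (v - gradf A gf v) ltr01).
  move=> /le_trans; apply.
  rewrite (_ : _ - _ - _ = (u - v) - (gradf A gf u - gradf A gf v)); last first.
    by apply/colP => c; rewrite !mxE; ring.
  by apply: le_trans (enormD _ _) _; rewrite enormN lerD2l.
by apply: le_trans (lerD (lexx _) h) _; lra.
Qed.

(** Sums over all [i] bound the contribution of any batch. Crude constants suffice, as they enter
    the summability bounds and not the step size condition. *)
Definition Cdist := \sum_i opnorm (A i) ^+ 2 * (Li i + gam i).
Definition Ctol := \sum_i opnorm (A i) * (Li i + gam i).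

Let Lg0 i : 0 <= Li i + gam i. Proof. exact: addr_ge0. Qed.

Lemma Cdist_ge0 : 0 <= Cdist.
Proof. by apply: sumr_ge0 => i _; rewrite mulr_ge0 // sqr_ge0. Qed.

Lemma Ctol_ge0 : 0 <= Ctol.
Proof. by apply: sumr_ge0 => i _; rewrite mulr_ge0. Qed.

Lemma mean_enorm_le (F : 'I_b -> 'cV[R]_n) c : (forall j, enorm (F j) <= c) ->
  enorm (b%:R^-1 *: \sum_j F j) <= c.
Proof.
move=> Fc; rewrite enormZ ger0_norm ?invr_ge0 // ler_pdivrMl ?ltr0n //.
apply: le_trans (enorm_sum _) _.
apply: le_trans (ler_sum _ (fun j _ => Fc j)) _.
by rewrite sumr_const card_ord mulr_natl.
Qed.

(** The exact gradient at [x] minus the variance-reduced estimator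
    [gradfS x + gradf xt - gradfS xt]. *)
Definition vr_error (S : 'I_b -> 'I_N) (x xt : 'cV[R]_n) :=
  gradf A gf x - gradfS A gf S x - (gradf A gf xt - gradfS A gf S xt).

(** The error is the population mean minus the sample mean of the vectors [z i], whose norms are at
    most [K |x - xt|]. *)
Lemma vr_error_variance x xt (K : R) :
  (forall i, Li i * opnorm (A i) ^+ 2 <= K) ->
  N%:R^-1 ^+ b * \sum_(S : {ffun 'I_b -> 'I_N}) enorm (vr_error S x xt) ^+ 2
    <= K ^+ 2 / b%:R * enorm (x - xt) ^+ 2.
Proof.
move=> hK; pose z i := (A i)^T *m (gf i (A i *m x) - gf i (A i *m xt)).
have -> : \sum_(S : {ffun 'I_b -> 'I_N}) enorm (vr_error S x xt) ^+ 2 =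
    \sum_(S : {ffun 'I_b -> 'I_N})
      enorm (N%:R^-1 *: \sum_i z i - b%:R^-1 *: \sum_j z (S j)) ^+ 2.
  apply: eq_bigr => S _; congr (enorm _ ^+ 2).
  rewrite /vr_error /gradf /gradfS /z.
  under [in RHS]eq_bigr do rewrite mulmxBr.
  under [X in _ = _ - _ *: X]eq_bigr do rewrite mulmxBr.
  rewrite !sumrB !scalerBr !opprB.
  by apply/colP => c; rewrite !mxE; ring.
apply: le_trans (sample_variance z N0 b0) _.
rewrite mulrAC (mulrC _ b%:R^-1) ler_pM2l ?invr_gt0 ?ltr0n //.
rewrite ler_pdivrMl ?ltr0n //.
apply: (@le_trans _ _ (\sum_(i < N) K ^+ 2 * enorm (x - xt) ^+ 2)); last first.
  by rewrite sumr_const card_ord mulr_natl.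
apply: ler_sum => i _; rewrite -exprMn.
have K0 : 0 <= K by apply: le_trans (hK i); rewrite mulr_ge0 // sqr_ge0.
rewrite ler_pXn2r ?nnegrE ?mulr_ge0 //.
apply: le_trans (opnorm_tr_le _ _) _.
apply: (@le_trans _ _ (opnorm (A i) * (Li i * (opnorm (A i) * enorm (x - xt))))).
  rewrite ler_wpM2l //; have [_ _ lip] := smooth i.
  apply: le_trans (lip _ _) _; rewrite ler_wpM2l // -mulmxBr.
  exact: opnorm_le.
rewrite [leLHS](_ : _ = Li i * opnorm (A i) ^+ 2 * enorm (x - xt)).
  by rewrite ler_wpM2r.
ring.
Qed.

Section OneStep.
Variables (S : 'I_b -> 'I_N) (alpha eps : R) (x xt : 'cV[R]_n) (xi : @dualvar R N mi b).
Hypotheses (alpha0 : 0 < alpha) (alpha1 : alpha <= 1).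
Let v := gradf A gf xt - gradfS A gf S xt.
Let vhat := alpha *: (v - MS A gam S *m x).
Let y := prox alpha (x - alpha *: AtS A S xi - vhat).
Hypothesis xi_dom : forall j, int_dom (conjugate (fhat f gam (S j))) (xi j (S j)).
Hypothesis xi_tol : Vnorm A gconj prox S alpha x (- vhat) xi <= eps.

Let g := AtS A S xi + v - MS A gam S *m x.

Lemma prox_argE : x - alpha *: AtS A S xi - vhat = x - alpha *: g.
Proof. by rewrite /vhat /g -!addrA -opprD -scalerDr. Qed.

Let z j := gconj (S j) (xi j (S j)).
Let err := b%:R^-1 *: \sum_j (A (S j))^T *m (ghat (S j) (z j) - ghat (S j) (A (S j) *m y)).
Let mon := b%:R^-1 *:
  \sum_j (A (S j))^T *m (ghat (S j) (A (S j) *m y) - ghat (S j) (A (S j) *m x)).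

(** As [xi_j = ghat (z_j)], inserting [ghat] at [A_j y] and at [A_j x] splits [xi_j - gam_j A_j x]
    into a tolerance error, a term monotone in the displacement [y - x], and the sampled gradient at
    [x]. *)
Lemma step_gradientE : g = err + mon + gradf A gf x - vr_error S x xt.
Proof.
have xiE j : xi j (S j) = ghat (S j) (z j).
  apply: (conjugate_grad (@ghat_grad (S j)) (@fhat_convex (S j)) (xi_dom j)).
  by have [_ + _] := conj_diff (S j); apply.
have e : AtS A S xi - MS A gam S *m x = err + mon + gradfS A gf S x.
  rewrite /AtS /MS /err /mon /gradfS -!scalerDr -!big_split /= -scalemxAl.
  rewrite mulmx_suml -scalerBr -sumrB; congr (_ *: _); apply: eq_bigr => j _.
  rewrite xiE -scalemxAl -mulmxA scalemxAr -!mulmxDr -mulmxBr; congr (_ *m _).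
  by rewrite /ghat; apply/colP => c; rewrite !mxE; ring.
rewrite /g addrAC e /vr_error -/v.
by apply/colP => c; rewrite !mxE; ring.
Qed.

Lemma err_le : enorm err <= Ctol * eps.
Proof.
apply: mean_enorm_le => j; apply: le_trans (opnorm_tr_le _ _) _.
have e_le : enorm (z j - A (S j) *m y) <= eps.
  apply: le_trans xi_tol; rewrite /Vnorm -/y -[leLHS]ger0_norm // -sqrtr_sqr.
  apply: ler_wsqrtr; rewrite (bigD1 j) //= -/y lerDl sumr_ge0 // => i _.
  exact: sqr_ge0.
apply: (@le_trans _ _ (opnorm (A (S j)) * ((Li (S j) + gam (S j)) * eps))).
  rewrite ler_wpM2l //; apply: le_trans (ghat_lip _ _) _.
  by rewrite ler_wpM2l.
have eps0 : 0 <= eps by apply: le_trans e_le.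
rewrite mulrA ler_wpM2r // /Ctol (bigD1 (S j)) //= lerDl.
by rewrite sumr_ge0 // => i _; rewrite mulr_ge0.
Qed.

Lemma mon_le : enorm mon <= Cdist * enorm (y - x).
Proof.
apply: mean_enorm_le => j; apply: le_trans (opnorm_tr_le _ _) _.
apply: (@le_trans _ _ (opnorm (A (S j)) *
    ((Li (S j) + gam (S j)) * (opnorm (A (S j)) * enorm (y - x))))).
  rewrite ler_wpM2l //; apply: le_trans (ghat_lip _ _) _.
  by rewrite ler_wpM2l // -mulmxBr opnorm_le.
rewrite [leLHS](_ : _ =
  opnorm (A (S j)) ^+ 2 * (Li (S j) + gam (S j)) * enorm (y - x)); last by ring.
rewrite ler_wpM2r // /Cdist (bigD1 (S j)) //= lerDl.
by rewrite sumr_ge0 // => i _; rewrite mulr_ge0 // sqr_ge0.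
Qed.

(** Monotonicity of the gradients of the convex [fhat]; it allows [mon] to be dropped from the
    descent estimate. *)
Lemma mon_ge0 : 0 <= dotv mon (y - x).
Proof.
rewrite /mon dotvZl dotv_suml mulr_ge0 ?invr_ge0 // sumr_ge0 // => j _.
rewrite dotv_mulmx mulmxBr; apply: (@grad_monotone _ _ (fhat f gam (S j))).
  exact: ghat_grad.
exact: fhat_convex.
Qed.

(** The subgradient inequality at [y], tested at [x], is added to the descent lemma for [fsum]. The
    terms in [gradf x] cancel, and the proximal step contributes the full [|y - x|^2]. *)
Lemma step_descent : (phi x < +oo)%E ->
  alpha * (fsum A f y + fine (phi y)) <= alpha * (fsum A f x + fine (phi x))
    - enorm (y - x) ^+ 2 + alpha * (Ctol * eps * enorm (y - x) +
        dotv (vr_error S x xt) (y - x) + L * enorm (y - x) ^+ 2).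
Proof.
move=> xf; have hy := proxP _ (x - alpha *: AtS A S xi - vhat) alpha0.
have := prox_subgrad phi_proper phi_convex alpha0 hy xf; rewrite -/y prox_argE.
have := lipschitz_grad_descent x (y - x) fsum_grad L0 gradf_lip.
rewrite (addrC x) subrK => hf.
have -> : x - alpha *: g - y = - (y - x) - alpha *: g.
  by apply/colP => c; rewrite !mxE; ring.
rewrite -[x - y]opprB step_gradientE; move: hf mon_ge0 err_le.
move: (y - x) err mon (vr_error S x xt) (gradf A gf x) => dl e mn q gx hf mn0 ele.
rewrite !(dotvDl, dotvNl, dotvNr, dotvZl) -enormE.
have := dotv_le (- e) dl; rewrite dotvNl enormN => h2.
have h1 : enorm e * enorm dl <= Ctol * eps * enorm dl by rewrite ler_wpM2r.
have := ler_wpM2l (ltW alpha0) hf.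
have := ler_wpM2l (ltW alpha0) (le_trans h2 h1).
have := mulr_ge0 (ltW alpha0) mn0.
lra.
Qed.

(** The residual with step [alpha] uses the exact proximal gradient point [p]; nonexpansiveness
    bounds [|y - p|] by [alpha] times the gradient error. *)
Lemma step_residual :
  alpha * enorm (residual x) <= enorm (y - x) +
    alpha * (Ctol * eps + Cdist * enorm (y - x) + enorm (vr_error S x xt)).
Proof.
have := prox_residual_le phi_proper phi_convex alpha0 alpha1
  (proxP _ (x - gradf A gf x) ltr01) (proxP _ (x - alpha *: gradf A gf x) alpha0).
set p := prox alpha _ => /le_trans; apply.
have -> : x - p = (y - p) - (y - x) by apply/colP => c; rewrite !mxE; ring.
apply: le_trans (enormD _ _) _; rewrite enormN addrC lerD2l.
have := prox_firm phi_proper phi_convex alpha0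
  (proxP _ (x - alpha *: AtS A S xi - vhat) alpha0)
  (proxP _ (x - alpha *: gradf A gf x) alpha0).
rewrite -/y -/p prox_argE => /le_trans; apply.
have -> : x - alpha *: g - (x - alpha *: gradf A gf x) =
    - alpha *: (err + mon - vr_error S x xt).
  by rewrite step_gradientE; apply/colP => c; rewrite !mxE; ring.
rewrite enormZ normrN gtr0_norm // ler_pM2l //.
apply: le_trans (enormD _ _) _; rewrite enormN lerD2r.
by apply: le_trans (enormD _ _) _; rewrite lerD // ?err_le ?mon_le.
Qed.

End OneStep.
End Step.

(** * Real sequences *)

Section Sequences.
Context {R : realType}.
Implicit Types (F U W : nat -> R).

Lemma psum_le F a b : (forall t, 0 <= F t) -> (a <= b)%N ->
  \sum_(t < a) F t <= \sum_(t < b) F t.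
Proof.
move=> F0 ab; rewrite -!(big_mkord xpredT F) (big_cat_nat (n := a) _ ab) //=.
by rewrite lerDl sumr_ge0.
Qed.

Lemma sum_stages F m S :
  \sum_(t < S * m) F t = \sum_(s < S) \sum_(k < m) F (s * m + k)%N.
Proof.
elim: S => [|S IH]; first by rewrite mul0n !big_ord0.
by rewrite big_ord_recr /= mulSnr big_split_ord /= IH.
Qed.

Lemma bounded_psum_tail W B : (forall t, 0 <= W t) ->
  (forall T, \sum_(t < T) W t <= B) ->
  forall e, 0 < e -> exists T0, forall T, \sum_(t < T) W t <= \sum_(t < T0) W t + e.
Proof.
move=> W0 WB e e0.
pose E : set R := range (fun T => \sum_(t < T) W t).
have supE : has_sup E.
  by split; [exists (\sum_(t < 0) W t), 0%N | exists B => _ [T _ <-]].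
have [_ [T0 _ <-] lt0] := sup_adherent e0 supE.
exists T0 => T; rewrite -lerBlDr; apply: le_trans (ltW lt0).
by rewrite lerB //; apply: sup_upper_bound => //; exists T.
Qed.

(** If [U t0 >= e] at a late time, the remaining variation of [U] is too small to bring it below
    [e / 2]. Then [al t <= (2 / e) W t] from [t0] on, and the sum of [al] would be finite. *)
Lemma vanishing U W al (B C : R) :
  (forall t, 0 <= W t) -> (forall t, 0 <= al t) -> (forall t, 0 <= U t) -> 0 <= C ->
  (forall T, \sum_(t < T) W t <= B) ->
  (forall t, `|U t.+1 - U t| <= C * W t) ->
  (forall t, al t * U t <= W t) ->
  (forall K, exists T, K < \sum_(t < T) al t) ->
  forall e, 0 < e -> exists T0, forall t, (T0 <= t)%N -> U t < e.
Proof.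
move=> W0 al0 U0 C0 WB UW alU div e e0.
(* A tail of [W] of size [e / (2 (C + 1))] keeps the total variation below [e / 2], also when
   [C = 0]. *)
have C1 : 0 < 2 * (C + 1) by rewrite mulr_gt0 // ltr_wpDl ?ltr01.
have [T0 tail] := bounded_psum_tail W0 WB (divr_gt0 e0 C1).
exists T0 => t0 T0t; rewrite ltNge; apply/negP => eU.
have drop_le k : U t0 - C * (\sum_(t < t0 + k) W t - \sum_(t < t0) W t) <= U (t0 + k)%N.
  elim: k => [|k IH]; first by rewrite addn0 subrr mulr0 subr0.
  rewrite addnS big_ord_recr /=; have := UW (t0 + k)%N.
  rewrite ler_norml => /andP[+ _]; lra.
have half_le k : e / 2 <= U (t0 + k)%N.
  apply: le_trans (drop_le k).
  have : C * (\sum_(t < t0 + k) W t - \sum_(t < t0) W t) <= C * (e / (2 * (C + 1))).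
    rewrite ler_wpM2l // lerBlDl; apply: le_trans (tail _) _.
    by rewrite lerD2r psum_le.
  have : C * (e / (2 * (C + 1))) <= e / 2.
    rewrite mulrA ler_pdivrMr //; nra.
  lra.
have al_le k : \sum_(t < t0 + k) al t - \sum_(t < t0) al t <= 2 / e * \sum_(t < t0 + k) W t.
  elim: k => [|k IH].
    by rewrite addn0 subrr mulr_ge0 ?sumr_ge0 // divr_ge0 // ltW.
  rewrite addnS !big_ord_recr /= mulrDr addrAC lerD //.
  rewrite -ler_pdivrMl ?divr_gt0 // invf_div mulrC; apply: le_trans (alU _).
  by rewrite ler_wpM2l.
have [T] := div (\sum_(t < t0) al t + 2 / e * B); apply/negP; rewrite -leNgt.
have := al_le T; have := WB (t0 + T)%N.
have : \sum_(t < T) al t <= \sum_(t < t0 + T) al t by rewrite psum_le // leq_addl.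
move=> h1 h2 h3; have e20 : 0 <= 2 / e by rewrite divr_ge0 // ltW.
have := ler_wpM2l e20 h2; lra.
Qed.

(** In terms of [r = d / al], the gap between the two sides is at least a sum of squares with
    nonnegative coefficients; [al <= 1] makes the last coefficient nonnegative. *)
Lemma residual_step_variation (u u' d l al : R) : 0 <= u -> 0 <= u' -> 0 <= d ->
  0 <= l -> 0 < al -> al <= 1 -> `|u' - u| <= l * d ->
  `|u' ^+ 2 - u ^+ 2| <= (l + l ^+ 2) * (d ^+ 2 / al + al * u ^+ 2).
Proof.
move=> u0 u'0 d0 l0 al0 al1; set r := d / al.
have dE : d = al * r by rewrite /r mulrC divfK // gt_eqF.
have r0 : 0 <= r by rewrite divr_ge0 // ltW.
have -> : d ^+ 2 / al = al * r ^+ 2 by rewrite dE; field; rewrite gt_eqF.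
rewrite dE => h.
have -> : u' ^+ 2 - u ^+ 2 = (u' - u) * (u' + u) by ring.
rewrite normrM (ger0_norm (addr_ge0 u'0 u0)).
apply: (@le_trans _ _ (l * (al * r) * (2 * u + l * (al * r)))).
  apply: ler_pM => //; first exact: addr_ge0.
  by move: h; rewrite ler_norml => /andP[_]; lra.
rewrite -subr_ge0.
have -> : (l + l ^+ 2) * (al * r ^+ 2 + al * u ^+ 2) - l * (al * r) * (2 * u + l * (al * r))
  = al * (l * (r - u) ^+ 2 + l ^+ 2 * u ^+ 2 + l ^+ 2 * r ^+ 2 * (1 - al)) by ring.
apply: mulr_ge0; first exact: ltW.
apply: addr_ge0; first by apply: addr_ge0; rewrite mulr_ge0 ?sqr_ge0.
by apply: mulr_ge0; [rewrite mulr_ge0 ?sqr_ge0 | rewrite subr_ge0].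
Qed.

Lemma residual_energy_le (u d al C1 C2 ep p : R) : 0 <= u -> 0 < al -> al <= 1 ->
  0 <= d -> 0 <= C1 -> 0 <= C2 -> 0 <= ep -> 0 <= p ->
  al * u <= d + al * (C2 * ep + C1 * d + p) ->
  al * u ^+ 2 <= 4 * ((1 + C1 ^+ 2) * (d ^+ 2 / al) + C2 ^+ 2 * (al * ep ^+ 2) + p ^+ 2).
Proof.
move=> u0 al0 al1 d0 C10 C20 ep0 p0; set r := d / al.
have dE : d = al * r by rewrite /r mulrC divfK // gt_eqF.
have r0 : 0 <= r by rewrite divr_ge0 // ltW.
have -> : d ^+ 2 / al = al * r ^+ 2 by rewrite dE; field; rewrite gt_eqF.
rewrite dE -mulrDr ler_pM2l // => h.
have h' : u <= r + (C2 * ep + C1 * r + p).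
  apply: le_trans h _; rewrite lerD2l lerD2r lerD2l ler_wpM2l //.
  by rewrite ler_piMl.
have uu : u ^+ 2 <= (r + (C2 * ep + C1 * r + p)) ^+ 2.
  by rewrite ler_pXn2r ?nnegrE // !addr_ge0 // mulr_ge0.
have sq : (r + (C2 * ep + C1 * r + p)) ^+ 2 <=
    4 * (r ^+ 2 + (C2 * ep) ^+ 2 + (C1 * r) ^+ 2 + p ^+ 2).
  have := sqr_ge0 (r - C2 * ep); have := sqr_ge0 (r - C1 * r).
  have := sqr_ge0 (r - p); have := sqr_ge0 (C2 * ep - C1 * r).
  have := sqr_ge0 (C2 * ep - p); have := sqr_ge0 (C1 * r - p).
  move: (C2 * ep) (C1 * r) => x1 x2; nra.
apply: le_trans (_ : _ <= al * (4 * (r ^+ 2 + (C2 * ep) ^+ 2 + (C1 * r) ^+ 2 + p ^+ 2))) _.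
  by rewrite ler_pM2l // (le_trans uu).
have : al * p ^+ 2 <= p ^+ 2 by rewrite ler_piMl // sqr_ge0.
rewrite !exprMn; lra.
Qed.

(** Induction, using [m^2 / 2 + m <= (m + 1)^2 / 2]. This is the source of the factor [m / sqrt 2]
    in the step size bound. *)
Lemma stage_double_sum (D : nat -> R) m : (forall t, 0 <= D t) ->
  \sum_(k < m) k%:R * \sum_(l < k) D l <= m%:R ^+ 2 / 2 * \sum_(l < m) D l.
Proof.
move=> D0; elim: m => [|m IH]; first by rewrite !big_ord0 mulr0.
rewrite !big_ord_recr /= -natr1; set S := \sum_(l < m) D l in IH *.
have S0 : 0 <= S by apply: sumr_ge0.
have := D0 m; have : 0 <= (m%:R + 1) ^+ 2 / 2 * D m :> R.
  by rewrite mulr_ge0 // divr_ge0 // sqr_ge0.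
lra.
Qed.

(* Descent is only required for t > 0: phi may be infinite at the starting point
   of the algorithm, but it is finite at every later iterate. *)
Lemma stage_summable (m : nat) (a q D al ep : nat -> R)
    (eta L tau c3 c4 E : R) :
  (0 < m)%N -> 0 < eta < 1 -> 0 <= tau -> 0 <= L -> 0 <= c3 -> 0 <= c4 ->
  (forall t, 0 <= D t) -> (forall t, 0 <= q t) -> (forall t, (0 < t)%N -> 0 <= a t) ->
  (forall t, 0 < al t <= 1) -> (forall t, al t * (L + tau) <= eta) ->
  (forall T, \sum_(t < T) al t * ep t ^+ 2 <= E) ->
  m%:R ^+ 2 / 2 * c4 <= tau ^+ 2 ->
  let sig := (1 - eta) / 4 in let th := tau + sig in
  (forall t, (0 < t)%N -> a t.+1 <= a t + q t / (2 * th) + (th / 2 + L) * D t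
     - (1 - sig) * (D t / al t) + c3 * (al t * ep t ^+ 2)) ->
  (forall s k, (k < m)%N ->
     q (s * m + k)%N <= c4 * (k%:R * \sum_(l < k) D (s * m + l)%N)) ->
  exists B, forall T, \sum_(t < T) D t / al t <= B /\ \sum_(t < T) q t <= B.
Proof.
move=> m0 /andP[eta0 eta1] tau0 L0 c30 c40 D0 q0 a0 al01 alL epE c4tau sig th da dq.
have sig0 : 0 < sig by rewrite divr_gt0 // subr_gt0.
have th0 : 0 < th by rewrite /th ltr_wpDl.
have Dal t : 0 <= D t / al t.
  by rewrite divr_ge0 //; case/andP: (al01 t) => /ltW.
have D_le t : D t <= D t / al t.
  by case/andP: (al01 t) => p1 p2; rewrite ler_pdivlMr // ler_piMr.
have q_stage s : \sum_(k < m) q (s * m + k)%N <= tau ^+ 2 * \sum_(k < m) D (s * m + k)%N.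
  apply: le_trans (_ : _ <= c4 * (m%:R ^+ 2 / 2 * \sum_(k < m) D (s * m + k)%N)) _.
    apply: (@le_trans _ _ (\sum_(k < m) c4 * (k%:R * \sum_(l < k) D (s * m + l)%N))).
      by apply: ler_sum => k _; exact: dq.
    rewrite -mulr_sumr ler_wpM2l //.
    exact: (stage_double_sum (D := fun l => D (s * m + l)%N)).
  by rewrite mulrA ler_wpM2r ?sumr_ge0 // mulrC.
(* This is [(1 - sig) - (eta + sig)]: what is left of the decrease in [D / al] once [(th + L) D] is
   absorbed. *)
pose ch := (1 - eta) / 2.
have ch0 : 0 < ch by rewrite divr_gt0 // subr_gt0.
have a_stage s : (0 < s)%N -> a (s.+1 * m)%N + ch * \sum_(k < m) D (s * m + k)%N / al (s * m + k)%N
    <= a (s * m)%N + c3 * \sum_(k < m) al (s * m + k)%N * ep (s * m + k)%N ^+ 2.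
  move=> s0.
  have tele k : (k <= m)%N -> a (s * m + k)%N <= a (s * m)%N + (\sum_(l < k) q (s * m + l)%N) / (2 * th)
      + (th / 2 + L) * (\sum_(l < k) D (s * m + l)%N)
      - (1 - sig) * (\sum_(l < k) D (s * m + l)%N / al (s * m + l)%N)
      + c3 * (\sum_(l < k) al (s * m + l)%N * ep (s * m + l)%N ^+ 2).
    elim: k => [_|k IH km]; first by rewrite !big_ord0 addn0; lra.
    have sk : (0 < s * m + k)%N by rewrite addn_gt0 muln_gt0 s0 m0.
    rewrite addnS !big_ord_recr /=; have := da _ sk; have := IH (ltnW km); lra.
  have := tele m (leqnn m); rewrite -mulSnr.
  (* Since [tau <= th], the Young weight [th] balances this term with [th / 2 * D]; together they
     make [th * D]. *)
  have : (\sum_(l < m) q (s * m + l)%N) / (2 * th) <= th / 2 * \sum_(l < m) D (s * m + l)%N.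
    rewrite ler_pdivrMr ?mulr_gt0 //; apply: le_trans (q_stage s) _.
    have -> : th / 2 * (\sum_(l < m) D (s * m + l)%N) * (2 * th) =
      th ^+ 2 * \sum_(l < m) D (s * m + l)%N by field.
    rewrite ler_wpM2r ?sumr_ge0 // ler_pXn2r ?nnegrE //; [|exact: ltW].
    by rewrite lerDl ltW.
  have : (th + L) * (\sum_(l < m) D (s * m + l)%N) <=
      (eta + sig) * \sum_(l < m) D (s * m + l)%N / al (s * m + l)%N.
    rewrite !mulr_sumr; apply: ler_sum => l _; set t := (s * m + l)%N.
    case/andP: (al01 t) => p1 p2.
    rewrite !mulrA ler_pdivlMr // -mulrA (mulrC (D t)) mulrA ler_wpM2r //.
    have := alL t; rewrite /th; have : sig * al t <= sig by rewrite ler_piMr // ltW.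
    lra.
  rewrite /ch; rewrite /sig; lra.
have tot S : a (S.+1 * m)%N + ch * \sum_(t < S.+1 * m) D t / al t <=
    a m + ch * (\sum_(t < m) D t / al t) + c3 * \sum_(t < S.+1 * m) al t * ep t ^+ 2.
  have pos k : 0 <= al k * ep k ^+ 2.
    by rewrite mulr_ge0 ?sqr_ge0 //; case/andP: (al01 k) => /ltW.
  elim: S => [|S IH].
    by rewrite mul1n lerDl mulr_ge0 // sumr_ge0.
  have spl F : \sum_(t < S.+2 * m) F t =
      \sum_(t < S.+1 * m) F t + \sum_(k < m) F (S.+1 * m + k)%N.
    by rewrite sum_stages big_ord_recr -sum_stages.
  have := a_stage S.+1 isT.
  rewrite (spl (fun t => D t / al t)) (spl (fun t => al t * ep t ^+ 2)); lra.
pose B1 := (a m + ch * (\sum_(t < m) D t / al t) + c3 * E) / ch.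
have DB T : \sum_(t < T) D t / al t <= B1.
  have TT : (T <= T.+1 * m)%N by rewrite (leq_trans (leqnSn T)) // leq_pmulr.
  apply: le_trans (psum_le Dal TT) _.
  rewrite ler_pdivlMr // mulrC.
  have := tot T; have := a0 (T.+1 * m)%N; rewrite muln_gt0 m0 => /(_ isT).
  have := ler_wpM2l c30 (epE (T.+1 * m)%N); lra.
have QB T : \sum_(t < T) q t <= tau ^+ 2 * B1.
  have TT : (T <= T * m)%N by rewrite leq_pmulr.
  apply: le_trans (psum_le q0 TT) _; rewrite sum_stages.
  apply: (@le_trans _ _ (\sum_(s < T) tau ^+ 2 * \sum_(k < m) D (s * m + k)%N)).
    by apply: ler_sum => s _.
  rewrite -mulr_sumr ler_wpM2l ?sqr_ge0 // -(sum_stages D).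
  by apply: le_trans (DB (T * m)%N); apply: ler_sum => t _.
exists (Num.max B1 (tau ^+ 2 * B1)) => T.
by rewrite !le_max DB QB orbT.
Qed.

End Sequences.

(** * Expectations over finite histories *)

Section FiniteHistory.
Context {R : realType} (d : measure_display) (Omega : measurableType d).
Context (P : probability Omega R).
Variables (B : finType) (bt : nat -> Omega -> B) (c : R).
Hypothesis cB : c * #|B|%:R = 1.
Hypothesis bt_meas : forall t (v : nat -> B),
  measurable [set w | forall i, (i < t)%N -> bt i w = v i].
Hypothesis bt_prob : forall t (v : nat -> B),
  P [set w | forall i, (i < t)%N -> bt i w = v i] = (c ^+ t)%:E.

Let c0 : 0 < c.
Proof.
have : 0 < c * #|B|%:R by rewrite cB ltr01.
by case: (ltP 0 c) => // h; rewrite ltNge mulr_le0_ge0.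
Qed.

(** The most recent batch comes first, so that conditioning on the past amounts to averaging over
    the head. *)
Fixpoint hist t w : t.-tuple B :=
  if t is t'.+1 then [tuple of bt t' w :: hist t' w] else [tuple].

Lemma hist_eq t w w' : hist t w = hist t w' ->
  forall i, (i < t)%N -> bt i w = bt i w'.
Proof.
elim: t => // t IH /(congr1 val) /= [e /val_inj /IH {}IH] i.
by rewrite ltnS leq_eqVlt => /predU1P[->|/IH].
Qed.

Lemma hist_setE t (h : t.-tuple B) : exists v : nat -> B,
  [set w | hist t w = h] = [set w | forall i, (i < t)%N -> bt i w = v i].
Proof.
elim: t h => [h|t IH h].
  (* The total function [v] needs a value even for the empty history; [cB] rules out an empty
     [B]. *)
  have [b|noB] := pickP (@predT B).
    exists (fun=> b); apply/seteqP; split=> w //= _.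
    by rewrite [h]tuple0.
  exfalso; move: cB; rewrite (eq_card0 noB) mulr0 => /esym/eqP.
  by rewrite oner_eq0.
case/tupleP: h => b h; have [v hv] := IH h.
exists (fun i => if i == t then b else v i); apply/seteqP; split=> w /=.
  move=> /(congr1 val) /= [e /val_inj hw] i; rewrite ltnS leq_eqVlt.
  case: eqP => [-> //|_ /= it].
  by have : [set w | hist t w = h] w by []; rewrite hv; apply.
move=> H; have bw : bt t w = b by rewrite H // eqxx.
have hw : [set w | hist t w = h] w.
  by rewrite hv => i it; rewrite H ?ltnS 1?ltnW // (ltn_eqF it).
by apply: val_inj; rewrite /= bw hw.
Qed.

Lemma hist_measurable t (h : t.-tuple B) : measurable [set w | hist t w = h].
Proof. by have [v ->] := hist_setE h. Qed.

Lemma hist_prob t (h : t.-tuple B) : P [set w | hist t w = h] = (c ^+ t)%:E.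
Proof. by have [v ->] := hist_setE h. Qed.

(** Each history has positive probability, so its event is nonempty; this provides the
    representatives in [mean]. *)
Lemma hist_surj t (h : t.-tuple B) : exists w, hist t w = h.
Proof.
apply: contrapT => /forallNP noh.
have := hist_prob h.
have -> : [set w | hist t w = h] = set0 by rewrite -subset0 => w /noh.
by rewrite measure0 => -[] /eqP; rewrite eq_sym gt_eqF // exprn_gt0.
Qed.

Definition hist_rep t (h : t.-tuple B) : Omega := projT1 (cid (hist_surj h)).

Lemma hist_repK t (h : t.-tuple B) : hist t (hist_rep h) = h.
Proof. by rewrite /hist_rep; case: cid. Qed.

(** Measurability with respect to the first [t] batches, stated as factorization through a finite
    set. *)
Definition determined t (X : Type) (g : Omega -> X) :=
  forall w w', hist t w = hist t w' -> g w = g w'.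

Lemma determinedS t X (g : Omega -> X) : determined t g -> determined t.+1 g.
Proof. by move=> dg w w' /(congr1 val) /= [_ /val_inj]; exact: dg. Qed.

Lemma determined_le t t' X (g : Omega -> X) :
  (t <= t')%N -> determined t g -> determined t' g.
Proof.
move=> tt' dg; rewrite -(subnK tt'); elim: (t' - t)%N => // k IH.
by rewrite addSn; exact: determinedS.
Qed.

(* All histories of length t have probability c ^ t, so this is the expectation
   of g whenever g is determined by the history (integral_mean). *)
Definition mean t (g : Omega -> R) := c ^+ t * \sum_(h : t.-tuple B) g (hist_rep h).

Lemma mean_le t g g' : (forall w, g w <= g' w) -> mean t g <= mean t g'.
Proof.
by move=> gg'; rewrite ler_wpM2l ?exprn_ge0 ?(ltW c0) // ler_sum.
Qed.

Lemma mean_ge0 t g : (forall w, 0 <= g w) -> 0 <= mean t g.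
Proof. by move=> g0; rewrite mulr_ge0 ?exprn_ge0 ?sumr_ge0 ?(ltW c0). Qed.

Lemma meanD t g g' : mean t (fun w => g w + g' w) = mean t g + mean t g'.
Proof. by rewrite /mean big_split mulrDr. Qed.

Lemma meanZ t a g : mean t (fun w => a * g w) = a * mean t g.
Proof. by rewrite /mean -mulr_sumr mulrCA. Qed.

Lemma mean_sum t I (r : seq I) (g : I -> Omega -> R) :
  mean t (fun w => \sum_(i <- r) g i w) = \sum_(i <- r) mean t (g i).
Proof. by rewrite /mean exchange_big mulr_sumr. Qed.

Lemma mean_normB t g g' :
  `|mean t g - mean t g'| <= mean t (fun w => `|g w - g' w|).
Proof.
rewrite /mean -mulrBr normrM ger0_norm ?exprn_ge0 ?(ltW c0) //.
by rewrite ler_wpM2l ?exprn_ge0 ?(ltW c0) // -sumrB ler_norm_sum.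
Qed.

(** The tower property: average first over batch [t] with the past fixed, then over the past. *)
Lemma mean_tower t g :
  mean t.+1 g = mean t (fun w => c * \sum_(b : B) g (hist_rep [tuple of b :: hist t w])).
Proof.
rewrite /mean exprSr -mulrA; congr (_ * _); rewrite -mulr_sumr; congr (_ * _).
under [RHS]eq_bigr do under eq_bigr do rewrite hist_repK.
rewrite exchange_big pair_big /=.
rewrite (reindex (fun p : B * t.-tuple B => [tuple of p.1 :: p.2])) //.
exists (fun h : t.+1.-tuple B => (thead h, [tuple of behead h])) => [[b h] _|h _] /=.
  by rewrite theadE; congr (_, _); apply: val_inj.
by rewrite -tuple_eta.
Qed.

Lemma hist_rep_cons t b w :
  hist t (hist_rep [tuple of b :: hist t w]) = hist t w /\
  bt t (hist_rep [tuple of b :: hist t w]) = b.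
Proof. by have /(congr1 val) /= [-> /val_inj ->] := hist_repK [tuple of b :: hist t w]. Qed.

Lemma mean_const t a : mean t (fun=> a) = a.
Proof.
elim: t => [|t IH].
  by rewrite /mean sumr_const card_tuple expn0 mul1r mulr1n.
by rewrite mean_tower sumr_const -[_ *+ _]mulr_natl mulrA cB mul1r.
Qed.

Lemma mean_determinedS t g : determined t g -> mean t.+1 g = mean t g.
Proof.
move=> dg; rewrite mean_tower; congr (_ * _); apply: eq_bigr => h _.
under eq_bigr => b _ do rewrite (dg _ _ (hist_rep_cons t b (hist_rep h)).1).
by rewrite sumr_const -[_ *+ _]mulr_natl mulrA cB mul1r.
Qed.

Lemma mean_determined t t' g : (t <= t')%N -> determined t g -> mean t' g = mean t g.
Proof.
move=> tt' dg; rewrite -(subnK tt'); elim: (t' - t)%N => // k IH.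
rewrite addSn mean_determinedS //; apply: determined_le dg; exact: leq_addl.
Qed.

Lemma determined_indicE t (g : Omega -> R) : determined t g ->
  g = fun w => \sum_(h : t.-tuple B) g (hist_rep h) * (\1_[set w | hist t w = h] w : R).
Proof.
move=> dg; apply/funext => w; rewrite (bigD1 (hist t w)) //= indicE mem_set //.
rewrite mulr1 big1 ?addr0; first by apply: dg; rewrite hist_repK.
by move=> h /eqP hw; rewrite indicE memNset ?mulr0 // => /esym.
Qed.

Lemma determined_measurable t (g : Omega -> R) : determined t g -> measurable_fun [set: Omega] g.
Proof.
move=> /determined_indicE ->; apply: measurable_sum => h.
by apply: measurable_funM => //; apply: measurable_indic; exact: hist_measurable.
Qed.

Lemma integral_mean t (g : Omega -> R) : determined t g -> (forall w, 0 <= g w) ->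
  (\int[P]_w (g w)%:E)%E = (mean t g)%:E.
Proof.
move=> dg g0; rewrite [in LHS](determined_indicE dg).
under eq_integral do rewrite -sumEFin.
have mI h : measurable_fun [set: Omega] (\1_[set w | hist t w = h] : Omega -> R).
  by apply: measurable_indic; exact: hist_measurable.
rewrite ge0_integral_sum //=; first last.
- by move=> h w _; rewrite lee_fin mulr_ge0.
- by move=> h; apply/measurable_EFinP; apply: measurable_funM.
rewrite /mean mulr_sumr -sumEFin; apply: eq_bigr => h _.
under eq_integral do rewrite EFinM.
rewrite ge0_integralZl_EFin //; last exact/measurable_EFinP.
rewrite integral_indic //; last exact: hist_measurable.
rewrite setIT (_ : _ [set w | _] = (c ^+ t)%:E); last exact: hist_prob.
by rewrite -EFinM mulrC.
Qed.

(** By monotone convergence the series has integral at most [K]; it is therefore finite almost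
    everywhere and bounds its partial sums. *)
Lemma ae_bounded_psum (W : nat -> Omega -> R) K : (forall t w, 0 <= W t w) ->
  (forall t, determined t.+1 (W t)) ->
  (forall T, \sum_(t < T) mean t.+1 (W t) <= K) ->
  {ae P, forall w, exists M, forall T, \sum_(t < T) W t w <= M}.
Proof.
move=> W0 dW WK.
have mW t : measurable_fun [set: Omega] (fun w => (W t w)%:E).
  by apply/measurable_EFinP; exact: determined_measurable (dW t).
pose F w := (\sum_(0 <= t <oo) (W t w)%:E)%E.
have F0 w : (0 <= F w)%E by apply: nneseries_ge0 => t _ _; rewrite lee_fin.
have intF : (\int[P]_w F w <= K%:E)%E.
  rewrite integral_nneseries //; last by move=> t w _; rewrite lee_fin.
  apply: lime_le; first by apply: is_cvg_nneseries => t _ _; apply: integral_ge0 => w _; rewrite lee_fin.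
  apply: nearW => T; rewrite big_mkord.
  under eq_bigr => t _ do rewrite (integral_mean (dW t) (W0 t)).
  by rewrite sumEFin lee_fin.
have mF : measurable_fun [set: Omega] F.
  by apply: ge0_emeasurable_sum => // t w _ _; rewrite lee_fin.
have iF : P.-integrable [set: Omega] F.
  apply/integrableP; split => //.
  under eq_integral do rewrite gee0_abs //.
  exact: le_lt_trans intF (ltry _).
have := integrable_ae measurableT iF; apply: filterS => w /(_ I) Ff.
exists (fine (F w)) => T; rewrite -lee_fin fineK // -sumEFin -(big_mkord xpredT (fun t => (W t w)%:E)).
by apply: nneseries_lim_ge => t _ _; rewrite lee_fin.
Qed.

End FiniteHistory.

(** * The flattened iteration *)

Section FlatRun.
Unset Implicit Arguments.
Context {R : realType}.
Variables (N n : nat) (mi : 'I_N -> nat) (A : forall i : 'I_N, 'M[R]_(mi i, n)).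
Variables (f : forall i : 'I_N, 'cV[R]_(mi i) -> R).
Variables (gf : forall i : 'I_N, 'cV[R]_(mi i) -> 'cV[R]_(mi i)).
Variables (Li gam : 'I_N -> R) (phi : 'cV[R]_n -> \bar R).
Variables (prox : R -> 'cV[R]_n -> 'cV[R]_n).
Variables (gconj : forall i : 'I_N, 'cV[R]_(mi i) -> 'cV[R]_(mi i)).
Variables (L : R) (b m : nat).
Set Implicit Arguments.
Hypotheses (N0 : (0 < N)%N) (b0 : (0 < b)%N) (m0 : (0 < m)%N).
Hypothesis smooth : forall i, L_smooth (f i) (gf i) (Li i).
Hypothesis wconvex : forall i, weakly_convex (f i) (gam i).
Hypotheses (phi_proper : proper_efun phi) (phi_convex : convex_efun phi).
Hypothesis proxP : forall a y, 0 < a -> is_prox phi a y (prox a y).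
Hypotheses (L0 : 0 <= L) (gradf_lip : lipschitz_with (gradf A gf) L).
Hypothesis conj_diff : forall i,
  ess_differentiable (conjugate (fhat f gam i)) (gconj i).
Variable psi_low : R.
Hypothesis psi_lowP : forall y, (psi_low%:E <= (fsum A f y)%:E + phi y)%E.

Context (d : measure_display) (Omega : measurableType d) (P : probability Omega R).
Let B := {ffun 'I_b -> 'I_N}.
Let c : R := N%:R^-1 ^+ b.
Variable bt : nat -> Omega -> B.
Hypothesis bt_meas : forall t (v : nat -> B),
  measurable [set w | forall i, (i < t)%N -> bt i w = v i].
Hypothesis bt_prob : forall t (v : nat -> B),
  P [set w | forall i, (i < t)%N -> bt i w = v i] = (c ^+ t)%:E.

Variables (x : nat -> Omega -> 'cV[R]_n) (xi : nat -> Omega -> @dualvar R N mi b).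
Variables (al ep : nat -> R) (eta K E : R).
Hypothesis x_det : forall t, determined bt t (x t).
(** The reference point under Option I: the iterate at the start of the stage containing [t]. *)
Let xt t w := x (t %/ m * m)%N w.
Hypotheses (eta01 : 0 < eta < 1) (al01 : forall t, 0 < al t <= 1)
  (ep0 : forall t, 0 <= ep t).
Hypothesis LiK : forall i, Li i * opnorm (A i) ^+ 2 <= K.
Let tau := m%:R * K / Num.sqrt (2 * b%:R).
Hypothesis alL : forall t, al t * (L + tau) <= eta.
Hypothesis al_div : forall C, exists T, C < \sum_(t < T) al t.
Hypothesis epE : forall T, \sum_(t < T) al t * ep t ^+ 2 <= E.
Let vhat t w := al t *: (gradf A gf (xt t w) - gradfS A gf (bt t w) (xt t w)
                         - MS A gam (bt t w) *m x t w).
Hypothesis xi_dom : forall t w (j : 'I_b),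
  int_dom (conjugate (fhat f gam (bt t w j))) (xi t w j (bt t w j)).
Hypothesis xi_tol : forall t w,
  Vnorm A gconj prox (bt t w) (al t) (x t w) (- vhat t w) (xi t w) <= ep t.
Hypothesis x_step : forall t w,
  x t.+1 w = prox (al t) (x t w - al t *: AtS A (bt t w) (xi t w) - vhat t w).

Let cB : c * #|B|%:R = 1.
Proof.
rewrite card_ffun !card_ord natrX /c -exprMn mulVf ?expr1n //.
by rewrite pnatr_eq0 -lt0n.
Qed.

Let mn t := @mean R d Omega P B bt c cB bt_prob t.
Let dx t w := enorm (x t.+1 w - x t w).
Let u t w := enorm (residual A gf prox (x t w)).
Let pv t w := enorm (vr_error A gf (bt t w) (x t w) (xt t w)).
Let psi t w := fsum A f (x t w) + fine (phi (x t w)) - psi_low.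
Let D t := mn t.+1 (fun w => dx t w ^+ 2).
Let q t := mn t.+1 (fun w => pv t w ^+ 2).
Let W t w := dx t w ^+ 2 / al t + al t * u t w ^+ 2.

Let al0 t : 0 < al t. Proof. by case/andP: (al01 t). Qed.
Let al1 t : al t <= 1. Proof. by case/andP: (al01 t). Qed.
Let dx0 t w : 0 <= dx t w. Proof. exact: enorm_ge0. Qed.
Let u0 t w : 0 <= u t w. Proof. exact: enorm_ge0. Qed.
Let pv0 t w : 0 <= pv t w. Proof. exact: enorm_ge0. Qed.
Let C1 := Cdist A Li gam.
Let C2 := Ctol A Li gam.
Let C10 : 0 <= C1. Proof. exact: (Cdist_ge0 A smooth wconvex). Qed.
Let C20 : 0 <= C2. Proof. exact: (Ctol_ge0 A smooth wconvex). Qed.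
Let sig := (1 - eta) / 4.
Let sig0 : 0 < sig.
Proof. by rewrite divr_gt0 // subr_gt0; case/andP: eta01. Qed.
Let K0 : 0 <= K.
Proof.
apply: le_trans (LiK (Ordinal N0)); rewrite mulr_ge0 ?sqr_ge0 //.
by case: (smooth (Ordinal N0)).
Qed.
Let tau0 : 0 <= tau.
Proof. by rewrite divr_ge0 ?mulr_ge0 // sqrtr_ge0. Qed.
Let th := tau + sig.
Let th0 : 0 < th. Proof. by rewrite ltr_wpDl. Qed.
Let c0 : 0 <= c. Proof. by rewrite exprn_ge0 // invr_ge0. Qed.

Lemma phi_finite t w : (0 < t)%N -> (phi (x t w) < +oo)%E.
Proof.
case: t => // t _; rewrite x_step.
exact: (prox_finite phi_proper (al0 t) (proxP _ (al0 t))).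
Qed.

Lemma psi_ge0 t w : (0 < t)%N -> 0 <= psi t w.
Proof.
move=> t0; have := psi_lowP (x t w).
by rewrite (proper_fineK phi_proper (phi_finite w t0)) -EFinD lee_fin subr_ge0.
Qed.

Lemma psi_descent t w : (0 < t)%N ->
  psi t.+1 w <= psi t w + (2 * th)^-1 * pv t w ^+ 2 +
    (th / 2 + L - (1 - sig) / al t) * dx t w ^+ 2 +
    C2 ^+ 2 / (4 * sig) * (al t * ep t ^+ 2).
Proof.
move=> t0.
have := step_descent b0 smooth wconvex phi_proper phi_convex proxP L0 gradf_lip
  conj_diff (al0 t) (@xi_dom t w) (xi_tol t w) (phi_finite w t0).
rewrite -x_step -/(dx t w) -/C2 => h.
have := dotv_young (vr_error A gf (bt t w) (x t w) (xt t w)) (x t.+1 w - x t w) th0.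
rewrite -/(dx t w) -/(pv t w) => y1.
have y2 : C2 * ep t * dx t w <=
    sig * dx t w ^+ 2 / al t + C2 ^+ 2 / (4 * sig) * (al t * ep t ^+ 2).
  (* This square is the claim multiplied by [4 sig al]; only a fraction [sig] of the decrease is
     spent on the tolerance error. *)
  have s2 := sqr_ge0 (2 * sig * dx t w - al t * (C2 * ep t)).
  have fs0 : 0 < 4 * sig * al t by apply: mulr_gt0 => //; apply: mulr_gt0.
  rewrite -(ler_pM2l fs0).
  rewrite [leRHS](_ : _ = 4 * sig ^+ 2 * dx t w ^+ 2 + al t ^+ 2 * (C2 * ep t) ^+ 2).
    lra.
  by field; rewrite !gt_eqF.
rewrite -(ler_pM2l (al0 t)) /psi.
have h1 := ler_wpM2l (ltW (al0 t)) y1; have h2 := ler_wpM2l (ltW (al0 t)) y2.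
set X := (fsum A f (x t w) + _) in h *; set Y := (fsum A f (x t.+1 w) + _) in h *.
have al_div_mul r : al t * (r / al t) = r by rewrite mulrC divfK // gt_eqF.
have := al_div_mul (sig * dx t w ^+ 2); have := al_div_mul ((1 - sig) * dx t w ^+ 2).
move: h; lra.
Qed.

Lemma xt_det t : determined bt t (xt t).
Proof. exact: (determined_le (leq_trunc_div t m) (@x_det _)). Qed.

Lemma dx_det t : determined bt t.+1 (dx t).
Proof.
move=> w w' h; rewrite /dx (x_det h).
by rewrite (determinedS (@x_det t) h).
Qed.

Lemma u_det t : determined bt t (u t).
Proof. by move=> w w' h; rewrite /u (x_det h). Qed.

Lemma W_det t : determined bt t.+1 (W t).
Proof. by move=> w w' h; rewrite /W (dx_det h) (determinedS (@u_det t) h). Qed.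

Lemma psi_det t : determined bt t (psi t).
Proof. by move=> w w' h; rewrite /psi (x_det h). Qed.

(** Given the past, [x t] and [xt t] are fixed and batch [t] is uniform, so the one-step variance
    bound applies. The distance to the reference point telescopes into [k] increments. *)
Lemma variance_le s k : (k < m)%N ->
  q (s * m + k)%N <= K ^+ 2 / b%:R * (k%:R * \sum_(l < k) D (s * m + l)%N).
Proof.
move=> km; set t := (s * m + k)%N.
have xtE w : xt t w = x (s * m)%N w.
  by rewrite /xt /t divnMDl // divn_small // addn0.
apply: le_trans (_ : _ <= mn t (fun w => K ^+ 2 / b%:R * enorm (x t w - xt t w) ^+ 2)) _.
  rewrite /q /mn mean_tower; apply: mean_le => w.
  apply: le_trans (vr_error_variance N0 b0 smooth _ _ LiK).
  rewrite ler_wpM2l // le_eqVlt; apply/orP; left; apply/eqP.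
  apply: eq_bigr => S _.
  have [h bS] := hist_rep_cons cB bt_prob t S w.
  by rewrite /pv bS (x_det h) (xt_det h).
rewrite /mn meanZ ler_wpM2l ?divr_ge0 ?sqr_ge0 //.
have path w : enorm (x t w - xt t w) ^+ 2 <=
    k%:R * \sum_(l < k) dx (s * m + l)%N w ^+ 2.
  have -> : x t w - xt t w = \sum_(l < k) (x (s * m + l).+1 w - x (s * m + l)%N w).
    rewrite xtE /t; elim: k {km t xtE} => [|k IH]; first by rewrite addn0 subrr big_ord0.
    by rewrite big_ord_recr /= -IH addnS addrC subrKA.
  by apply: le_trans (enorm_sum_sqr _) _; rewrite card_ord.
apply: le_trans (mean_le cB bt_prob t path) _.
rewrite meanZ ler_wpM2l // mean_sum; apply: ler_sum => l _.
rewrite /D /mn (mean_determined cB bt_prob (t := (s * m + l).+1)) //.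
  by rewrite ltn_add2l.
by move=> w w' h; rewrite (dx_det h).
Qed.

Lemma mean_psi_descent t : (0 < t)%N ->
  mn t.+1 (psi t.+1) <= mn t (psi t) + q t / (2 * th) + (th / 2 + L) * D t
    - (1 - sig) * (D t / al t) + C2 ^+ 2 / (4 * sig) * (al t * ep t ^+ 2).
Proof.
move=> t0; apply: le_trans (mean_le cB bt_prob t.+1 (fun w => psi_descent w t0)) _.
rewrite 3!meanD !meanZ mean_const (mean_determinedS cB bt_prob (@psi_det t)).
rewrite -/(mn t.+1 (fun w => pv t w ^+ 2)) -/(mn t.+1 (fun w => dx t w ^+ 2)).
rewrite -/(D t) -/(q t) -/(mn t (psi t)); lra.
Qed.

Lemma energy_summable : exists M, forall T, \sum_(t < T) mn t.+1 (W t) <= M.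
Proof.
have Dge0 t : 0 <= D t by apply: mean_ge0 => w; exact: sqr_ge0.
have qge0 t : 0 <= q t by apply: mean_ge0 => w; exact: sqr_ge0.
have c30 : 0 <= C2 ^+ 2 / (4 * sig).
  by rewrite divr_ge0 ?sqr_ge0 // ltW // mulr_gt0.
have c40 : 0 <= K ^+ 2 / b%:R by rewrite divr_ge0 ?sqr_ge0.
have a0 t : (0 < t)%N -> 0 <= mn t (psi t).
  by move=> t0; apply: mean_ge0 => w; exact: psi_ge0.
have tauE : m%:R ^+ 2 / 2 * (K ^+ 2 / b%:R) <= tau ^+ 2.
  rewrite /tau expr_div_n sqr_sqrtr ?mulr_ge0 // le_eqVlt; apply/orP; left; apply/eqP.
  by field; rewrite pnatr_eq0 -lt0n.
have [M HM] := stage_summable m0 eta01 tau0 L0 c30 c40 Dge0 qge0 a0 al01 alL epE tauE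
  mean_psi_descent variance_le.
exists (M + 4 * ((1 + C1 ^+ 2) * M + C2 ^+ 2 * E + M)) => T.
have W_le t : mn t.+1 (W t) <= D t / al t +
    4 * ((1 + C1 ^+ 2) * (D t / al t) + C2 ^+ 2 * (al t * ep t ^+ 2) + q t).
  apply: le_trans (_ : _ <= mn t.+1 (fun w => (al t)^-1 * dx t w ^+ 2 +
      4 * ((1 + C1 ^+ 2) * ((al t)^-1 * dx t w ^+ 2) +
      C2 ^+ 2 * (al t * ep t ^+ 2) + pv t w ^+ 2))) _.
    apply: mean_le => w; rewrite /W (mulrC (_ ^+ 2)) lerD2l (mulrC _^-1).
    apply: residual_energy_le => //.
    have := step_residual b0 smooth wconvex phi_proper phi_convex proxP
      conj_diff (al0 t) (al1 t) (@xi_dom t w) (xi_tol t w).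
    by rewrite -x_step.
  rewrite /mn meanD !meanZ !meanD !meanZ mean_const.
  by rewrite -/(mn t.+1 (fun w => pv t w ^+ 2)) -/(mn t.+1 (fun w => dx t w ^+ 2)) -/(D t) -/(q t); lra.
apply: le_trans (ler_sum _ (fun (t : 'I_T) _ => W_le t)) _.
rewrite big_split /= -mulr_sumr !big_split /= -!mulr_sumr.
have [h1 h2] := HM T; have := epE T => h3.
have := ler_wpM2l (addr_ge0 ler01 (sqr_ge0 C1)) h1.
have := ler_wpM2l (sqr_ge0 C2) h3.
lra.
Qed.

Let W0 t w : 0 <= W t w.
Proof. by rewrite addr_ge0 ?divr_ge0 ?mulr_ge0 ?sqr_ge0 // ltW. Qed.

Let variation t w :
  `|u t.+1 w ^+ 2 - u t w ^+ 2| <= ((2 + L) + (2 + L) ^+ 2) * W t w.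
Proof.
apply: residual_step_variation => //; first exact: addr_ge0.
apply: le_trans (enorm_dist _ _) _.
exact: (residual_lip phi_proper phi_convex proxP gradf_lip).
Qed.

Let Cv0 : 0 <= (2 + L) + (2 + L) ^+ 2.
Proof. by rewrite addr_ge0 ?sqr_ge0 // addr_ge0. Qed.

Lemma mean_residual_vanishes e : 0 < e ->
  exists T0, forall t, (T0 <= t)%N -> mn t (u t) < e.
Proof.
move=> e0; have [M WM] := energy_summable.
have u2det t : determined bt t (fun w => u t w ^+ 2).
  by move=> w w' h; rewrite (u_det h).
have := @vanishing _ (fun t => mn t (fun w => u t w ^+ 2)) (fun t => mn t.+1 (W t)) al M
  ((2 + L) + (2 + L) ^+ 2) _ (fun t => ltW (al0 t)) _ Cv0 WM _ _ al_div (e ^+ 2) (exprn_gt0 _ e0).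
case.
- by move=> t; exact: mean_ge0.
- by move=> t; apply: mean_ge0 => w; exact: sqr_ge0.
- move=> t; rewrite /mn -(mean_determinedS cB bt_prob (u2det t)).
  apply: le_trans (mean_normB _ _ _ _ _) _.
  by rewrite /mn -meanZ; apply: mean_le => w.
- move=> t; rewrite /mn -(mean_determinedS cB bt_prob (u2det t)) -meanZ.
  by apply: mean_le => w; rewrite lerDr divr_ge0 ?sqr_ge0 // ltW.
move=> T0 hT; exists T0 => t /hT h.
(* Young's inequality passes from the second moment to the first: [u <= e / 2 + u^2 / (2 e)]. *)
have : mn t (u t) <= mn t (fun w => e / 2 + (2 * e)^-1 * u t w ^+ 2).
  apply: mean_le => w; rewrite -(ler_pM2l (x := 2 * e)) ?mulr_gt0 //.
  rewrite [leRHS](_ : _ = e ^+ 2 + u t w ^+ 2); last by field; rewrite gt_eqF.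
  by have := sqr_ge0 (e - u t w); lra.
rewrite /mn meanD mean_const meanZ => /le_lt_trans; apply.
rewrite {3}[e](_ : _ = e / 2 + (2 * e)^-1 * e ^+ 2); last by field; rewrite gt_eqF.
by rewrite ltrD2l ltr_pM2l // invr_gt0 mulr_gt0.
Qed.

Lemma integral_residual_cvg :
  (fun t => (\int[P]_w (enorm (residual A gf prox (x t w)))%:E)%E) @ \oo --> 0%E.
Proof.
have -> : (fun t => (\int[P]_w (enorm (residual A gf prox (x t w)))%:E)%E) =
    (fun t => (mn t (u t))%:E).
  by apply/funext => t; apply: integral_mean => //; exact: u_det.
apply: cvg_EFin; first exact: nearW.
apply/cvgrPdist_lt => e /mean_residual_vanishes[T0 hT].
exists T0 => // t /= /hT; rewrite sub0r normrN ger0_norm //.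
exact: mean_ge0.
Qed.

(** The sequence argument applies to each path on which the sums of [W] are bounded, that is, almost
    surely. *)
Lemma residual_cvg_ae :
  {ae P, forall w, (fun t => enorm (residual A gf prox (x t w))) @ \oo --> 0}.
Proof.
have [M WM] := energy_summable.
have := ae_bounded_psum bt_meas W0 W_det WM.
apply: filterS => w [Mw WMw].
apply/cvgrPdist_lt => e e0.
have := @vanishing _ (fun t => u t w ^+ 2) (fun t => W t w) al Mw
  ((2 + L) + (2 + L) ^+ 2) _ (fun t => ltW (al0 t)) _ Cv0 WMw _ _ al_div (e ^+ 2) (exprn_gt0 _ e0).
case=> //.
- by move=> t; exact: sqr_ge0.
- by move=> t; rewrite lerDr divr_ge0 ?sqr_ge0 // ltW.
move=> T0 hT; exists T0 => // t /= /hT; rewrite sub0r normrN ger0_norm //.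
rewrite ltr_pXn2r ?nnegrE //; exact: ltW.
Qed.

End FlatRun.

(** * Flattening the two-level time index *)

Section FlatTime.
Context {R : realType} (d : measure_display) (Omega : measurableType d).
Context (P : probability Omega R).
Variables (N m b : nat) (kappa : nat -> 'I_m -> 'I_b -> Omega -> 'I_N).
Hypotheses (m0 : (0 < m)%N).

Definition stage_ix t : 'I_m := Ordinal (ltn_pmod t m0).

Definition batch t w : {ffun 'I_b -> 'I_N} :=
  [ffun j => kappa (t %/ m)%N (stage_ix t) j w].

Lemma stage_divn s (k : 'I_m) : ((s * m + k) %/ m)%N = s.
Proof. by rewrite divnMDl // divn_small // addn0. Qed.

Lemma stage_modn s (k : 'I_m) : ((s * m + k) %% m)%N = k.
Proof. by rewrite modnMDl modn_small. Qed.

Lemma stage_ixE s (k : 'I_m) : stage_ix (s * m + k) = k.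
Proof. by apply: val_inj; exact: stage_modn. Qed.

Lemma batchE s (k : 'I_m) w j : batch (s * m + k) w j = kappa s k j w.
Proof. by rewrite ffunE stage_divn stage_ixE. Qed.

(** Pairs [(s, k)] up to the current one in lexicographic order are exactly those with flattened
    index at most [t]. *)
Lemma history_eq t w w' : (forall i, (i <= t)%N -> batch i w = batch i w') ->
  history kappa (t %/ m) (stage_ix t) w = history kappa (t %/ m) (stage_ix t) w'.
Proof.
move=> h; apply/funext => s; apply/funext => k; apply/funext => j.
rewrite /history; case: ifP => // sk; rewrite -!batchE h //.
rewrite [leqRHS](divn_eq t m); case/orP: sk => [st|/andP[/eqP -> kt]].
  apply: (@leq_trans (s.+1 * m)); first by rewrite mulSnr leq_add2l ltnW.
  by apply: leq_trans (leq_addr _ _); rewrite leq_mul2r st orbT.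
by rewrite leq_add2l.
Qed.

Hypothesis iid : iid_uniform P (fun t : nat * 'I_m * 'I_b => kappa t.1.1 t.1.2 t.2).

Let indices t := [seq (i %/ m, stage_ix i, j)%N | i <- iota 0 t, j <- enum 'I_b].

Let batches_setE t (v : nat -> {ffun 'I_b -> 'I_N}) :
  [set w | forall i, (i < t)%N -> batch i w = v i] =
  \bigcap_(p in [set p | p \in indices t])
    [set w | kappa p.1.1 p.1.2 p.2 w = v (p.1.1 * m + p.1.2)%N p.2].
Proof.
apply/seteqP; split => w /= h.
  move=> _ /= /allpairsP[[i j] /= [it _ ->]] /=.
  rewrite -divn_eq -h ?ffunE //.
  by move: it; rewrite mem_iota.
move=> i it; apply/ffunP => j; rewrite ffunE.
have /h /= -> : (i %/ m, stage_ix i, j)%N \in indices t.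
  apply/allpairsP; exists (i, j); split => //=; last exact: mem_enum.
  by rewrite mem_iota.
by rewrite -divn_eq.
Qed.

Lemma batches_measurable t (v : nat -> {ffun 'I_b -> 'I_N}) :
  measurable [set w | forall i, (i < t)%N -> batch i w = v i].
Proof.
rewrite batches_setE; apply: fin_bigcap_measurable; first exact: finite_seq.
by move=> p _; exact: (iid.1 p).
Qed.

Lemma batches_prob t (v : nat -> {ffun 'I_b -> 'I_N}) :
  P [set w | forall i, (i < t)%N -> batch i w = v i] = ((N%:R^-1 ^+ b) ^+ t)%:E.
Proof.
rewrite batches_setE.
rewrite (iid.2 (indices t) (fun p => v (p.1.1 * m + p.1.2)%N p.2)).
  by rewrite size_allpairs size_iota size_enum_ord mulnC exprM.
apply: allpairs_uniq; [exact: iota_uniq | exact: enum_uniq |].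
move=> [i j] [i' j'] _ _ /= [e1 e2 ->].
by rewrite (divn_eq i m) (divn_eq i' m) e1 e2.
Qed.

End FlatTime.

(** * Transfer to the two-level iteration *)

Unset Implicit Arguments. Set Strict Implicit. Set Printing Implicit Defensive.

Theorem theorem6p1
  (R : realType)
  (* problem dimensions and data *)
  (N n : nat) (mi : 'I_N -> nat) (A : forall i : 'I_N, 'M[R]_(mi i, n))
  (f : forall i : 'I_N, 'cV[R]_(mi i) -> R)
  (gf : forall i : 'I_N, 'cV[R]_(mi i) -> 'cV[R]_(mi i))
  (Li gam : 'I_N -> R)
  (phi : 'cV[R]_n -> \bar R)
  (prox : R -> 'cV[R]_n -> 'cV[R]_n)
  (gconj : forall i : 'I_N, 'cV[R]_(mi i) -> 'cV[R]_(mi i))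
  (L nu : R)
  (* algorithm parameters *)
  (m b : nat) (alpha eps : nat -> 'I_m -> R) (eta : R) (xt0 : 'cV[R]_n)
  (* probability space, samples, iterates *)
  (d : measure_display) (Omega : measurableType d) (P : probability Omega R)
  (kappa : nat -> 'I_m -> 'I_b -> Omega -> 'I_N)
  (xi : nat -> 'I_m -> Omega -> dualvar mi b)
  (x : nat -> nat -> Omega -> 'cV[R]_n) :
  (0 < N)%N -> (0 < m)%N -> (0 < b)%N ->
  (* (A1) *)
  (forall i, L_smooth (f i) (gf i) (Li i)) ->
  (forall i, weakly_convex (f i) (gam i)) ->
  (* phi proper closed convex, prox its proximal map *)
  proper_efun phi -> lsc_efun phi -> convex_efun phi ->
  (forall a y, 0 < a -> is_prox phi a y (prox a y)) ->
  (* L is a Lipschitz constant of nabla f *)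
  0 <= L -> lipschitz_with (gradf A gf) L ->
  (* (A2) *)
  (exists c : R, forall y, (c%:E <= (fsum A f y)%:E + phi y)%E) ->
  (* (A4) *)
  (forall i, ess_differentiable (conjugate (fhat f gam i)) (gconj i) /\
             loc_lipschitz_on (gconj i) (int_dom (conjugate (fhat f gam i)))) ->
  (* (A~3) *)
  0 < nu <= 1 ->
  (forall a, 0 < a -> semismooth_order nu (prox a) [set: 'cV[R]_n]) ->
  (* (A~5) *)
  (forall i, semismooth_order nu (gconj i) (int_dom (conjugate (fhat f gam i)))) ->
  (* step sizes and tolerances *)
  (forall s k, 0 < alpha s k) -> (forall s k, 0 <= eps s k) ->
  (fun S => \sum_(s < S) \sum_(k < m) alpha s k) @ \oo --> +oo ->
  cvg ((fun S => \sum_(s < S) \sum_(k < m) alpha s k * eps s k ^+ 2) @ \oo) ->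
  0 < eta < 1 ->
  (let Abar := max_over (fun i => opnorm (A i) ^+ 2) in
   let Lbar := max_over (fun i => Li i * opnorm (A i) ^+ 2) in
   let Mbar := max_over gam * Abar in
   let alpha_hat := eta / Num.max (2 * L + Mbar)
       ((1 + m%:R / Num.sqrt (2 * b%:R)) * Lbar + Num.max L Mbar) in
   forall s k, alpha s k <= Num.min 1 alpha_hat) ->
  (* sampling: all indices kappa s k j i.i.d. uniform on [N] *)
  iid_uniform P (fun t : nat * 'I_m * 'I_b => kappa t.1.1 t.1.2 t.2) ->
  (* xi^{s,k+1} is computed from the samples drawn so far *)
  (exists G : nat -> 'I_m -> (nat -> 'I_m -> 'I_b -> option 'I_N) -> dualvar mi b,
     forall s k w, xi s k w = G s k (history kappa s k w)) ->
  (* the SNSPP recursion, S = infinity, constant batch size b, Option I *)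
  (forall w, x 0%N 0%N w = xt0) ->
  (forall s w, x s.+1 0%N w = x s m w) ->
  (forall s (k : 'I_m) w,
     let S := fun j => kappa s k j w in
     let v := gradf A gf (x s 0%N w) - gradfS A gf S (x s 0%N w) in
     let vhat := alpha s k *: (v - MS A gam S *m x s k w) in
     [/\ (forall j, int_dom (conjugate (fhat f gam (S j))) (xi s k w j (S j))),
         Vnorm A gconj prox S (alpha s k) (x s k w) (- vhat) (xi s k w)
           <= eps s k &
         x s k.+1 w = prox (alpha s k)
                        (x s k w - alpha s k *: AtS A S (xi s k w) - vhat)]) ->
  (* conclusion *)
  let Fnat := fun y => y - prox 1 (y - gradf A gf y) in
  forall k : 'I_m,
    (fun s => (\int[P]_w (enorm (Fnat (x s k w)))%:E)%E) @ \oo --> 0%E /\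
    {ae P, forall w, (fun s => enorm (Fnat (x s k w))) @ \oo --> 0}.
Proof.
move=> N0 m0 b0 smooth wconvex phi_proper phi_lsc phi_convex proxP L0 gradf_lip
  [low lowP] A4 nu01 _ _ al0 ep0 al_infty alep_cvg eta01 al_le iid [G xiE]
  x0E xSE rec Fnat k.
have conj_diff i := (A4 i).1.
pose bt := batch kappa m0.
pose xx t w := x (t %/ m)%N (t %% m)%N w.
pose al t := alpha (t %/ m)%N (stage_ix m0 t).
pose ep t := eps (t %/ m)%N (stage_ix m0 t).
pose xf t w := xi (t %/ m)%N (stage_ix m0 t) w.
have xx0 s w : x s 0%N w = xx (s * m)%N w by rewrite /xx mulnK // modnMl.
have xxS t w : xx t.+1 w = x (t %/ m)%N (stage_ix m0 t).+1 w.
  have tm := ltn_pmod t m0; rewrite /xx /=.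
  have -> : t.+1 = (t %/ m * m + (t %% m).+1)%N by rewrite addnS -divn_eq.
  have [km|km] := ltnP (t %% m).+1 m.
    by rewrite divnMDl // modnMDl (divn_small km) (modn_small km) addn0.
  (* At the end of a stage the flattened index moves to the next stage, whose first point is [x s m]
     by Option I. *)
  have -> : (t %% m).+1 = m by apply/eqP; rewrite eqn_leq tm km.
  by rewrite -mulSnr mulnK // modnMl xSE.
(* The type of [xf t w j (S j)] depends on [S j], so the sampling function is abstracted in order to
   be replaced everywhere at once. *)
have step_fun t w (S : 'I_b -> 'I_N) :
  S = (fun j => kappa (t %/ m)%N (stage_ix m0 t) j w) ->
  let vh := al t *: (gradf A gf (xx (t %/ m * m)%N w) -
    gradfS A gf S (xx (t %/ m * m)%N w) - MS A gam S *m xx t w) in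
  [/\ forall j, int_dom (conjugate (fhat f gam (S j))) (xf t w j (S j)),
      Vnorm A gconj prox S (al t) (xx t w) (- vh) (xf t w) <= ep t &
      xx t.+1 w = prox (al t) (xx t w - al t *: AtS A S (xf t w) - vh)].
  by move=> -> vh; rewrite /vh -xx0 xxS; exact: rec.
have btE t w : (bt t w : 'I_b -> 'I_N) =
    (fun j => kappa (t %/ m)%N (stage_ix m0 t) j w).
  by apply/funext => j; exact: ffunE.
have step t w := step_fun t w _ (btE t w).
have x_det t : determined bt t (xx t).
  move=> w w' /hist_eq h.
  (* All earlier iterates are carried along, since a step uses the start of the stage as well as the
     current point. *)
  suff main i : (i <= t)%N -> forall l, (l <= i)%N -> xx l w = xx l w' by exact: (main t).
  elim: i => [_ l|i IH it l]; first by rewrite leqn0 => /eqP ->; rewrite /xx div0n mod0n !x0E.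
  rewrite leq_eqVlt => /predU1P[->|]; last by rewrite ltnS; exact: (IH (ltnW it)).
  have [_ _ ->] := step i w; have [_ _ ->] := step i w'.
  have IH' := IH (ltnW it).
  rewrite (IH' i) // (IH' (i %/ m * m)%N) ?leq_trunc_div // (h i it).
  have -> // : xf i w = xf i w'.
  rewrite /xf !xiE; congr (G _ _ _); apply: history_eq => l' li.
  exact: h (leq_ltn_trans li it).
set Lbar : R := max_over (fun i => Li i * opnorm (A i) ^+ 2) in al_le.
set Abar : R := max_over (fun i => opnorm (A i) ^+ 2) in al_le.
pose tau := m%:R * Lbar / Num.sqrt (2 * b%:R).
have LiK i : Li i * opnorm (A i) ^+ 2 <= Lbar by exact: le_bigmax.
have al01 t : 0 < al t <= 1.
  by rewrite al0 /=; have := al_le (t %/ m)%N (stage_ix m0 t); rewrite le_min => /andP[].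
have alL t : al t * (L + tau) <= eta.
  have := al_le (t %/ m)%N (stage_ix m0 t); rewrite le_min => /andP[_].
  cbv zeta; rewrite -/(al t); set X := Num.max _ _ => alX.
  (* A positive step below [eta / X] excludes [X = 0], where the quotient would be [0]. *)
  have X0 : 0 < X.
    have /andP[p1 _] := al01 t; have /andP[e0 _] := eta01.
    have := lt_le_trans p1 alX; rewrite pmulr_rgt0 // invr_gt0.
    by [].
  move: alX; rewrite ler_pdivlMr // => alX; apply: le_trans alX.
  rewrite ler_pM2l //; last by case/andP: (al01 t).
  (* The second entry of the maximum dominates [L + tau], because [tau = m Lbar / sqrt (2 b)] and
     [Lbar >= 0]. *)
  rewrite /X le_max; apply/orP; right.
  have Lbar0 : 0 <= Lbar by exact: bigmax_ge_id.
  have Lmax : L <= Num.max L (max_over gam * Abar) by rewrite le_max lexx.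
  by rewrite /tau; move: (Num.max L _) Lmax => M; lra.
have al_flat s (k' : 'I_m) : al (s * m + k')%N = alpha s k'.
  by rewrite /al stage_ixE stage_divn.
have ep_flat s (k' : 'I_m) : ep (s * m + k')%N = eps s k'.
  by rewrite /ep stage_ixE stage_divn.
have al_div C : exists T, C < \sum_(t < T) al t.
  have [S _ HS] := (cvgryPgt _).1 al_infty C.
  exists (S * m)%N; rewrite sum_stages.
  under eq_bigr do under eq_bigr do rewrite al_flat.
  exact: HS S (leqnn S).
pose u S := \sum_(s < S) \sum_(k < m) alpha s k * eps s k ^+ 2.
have epE T : \sum_(t < T) al t * ep t ^+ 2 <= limn u.
  have pos t : 0 <= al t * ep t ^+ 2 by rewrite mulr_ge0 ?sqr_ge0 // ltW //; exact: al0.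
  apply: le_trans (psum_le pos (leq_pmulr T m0)) _.
  rewrite (sum_stages (fun t => al t * ep t ^+ 2)).
  under eq_bigr do under eq_bigr do rewrite al_flat ep_flat.
  apply: (nondecreasing_cvgn_le (u_ := u)) => // S S' SS'.
  apply: (psum_le (F := fun s => \sum_(k < m) alpha s k * eps s k ^+ 2)) => // s.
  by apply: sumr_ge0 => k' _; rewrite mulr_ge0 ?sqr_ge0 // ltW.
have ep0' t : 0 <= ep t by exact: ep0.
have bt_meas := batches_measurable m0 iid.
have bt_prob := batches_prob m0 iid.
have xi_dom t w := let: And3 h _ _ := step t w in h.
have xi_tol t w := let: And3 _ h _ := step t w in h.
have x_step t w := let: And3 _ _ h := step t w in h.
have xE s w : x s k w = xx (s * m + k)%N w.
  by rewrite /xx stage_modn stage_divn.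
(* For fixed [k] the points [x s k] form a subsequence of the flattened iteration, so both limits
   carry over. *)
have to_oo : (fun s => s * m + k)%N @ \oo --> \oo.
  apply/cvgnyPge => B; exists B => // s /= Bs.
  by rewrite (leq_trans Bs) // (leq_trans (leq_pmulr s m0)) // leq_addr.
split.
  have -> : (fun s => \int[P]_w (enorm (Fnat (x s k w)))%:E)%E =
      (fun t => \int[P]_w (enorm (residual A gf prox (xx t w)))%:E)%E \o
      (fun s => s * m + k)%N.
    by apply/funext => s /=; apply: eq_integral => w _; rewrite xE.
  apply: cvg_comp to_oo _.
  exact: (integral_residual_cvg N0 b0 m0 smooth wconvex phi_proper phi_convex proxP L0
    gradf_lip conj_diff lowP bt_meas bt_prob x_det eta01 al01 ep0' LiK alL al_div epE
    xi_dom xi_tol x_step).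
have := residual_cvg_ae N0 b0 m0 smooth wconvex phi_proper phi_convex proxP L0
    gradf_lip conj_diff lowP bt_meas bt_prob x_det eta01 al01 ep0' LiK alL al_div epE
    xi_dom xi_tol x_step.
apply: filterS => w cv.
have -> : (fun s => enorm (Fnat (x s k w))) =
    (fun t => enorm (residual A gf prox (xx t w))) \o (fun s => s * m + k)%N.
  by apply/funext => s /=; rewrite xE.
exact: cvg_comp to_oo cv.
Qed.
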